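(* Let $S\subseteq[m]\times[n]$ be such that the $2$-way quasi-independence model $\mathcal{M}_S$ has rational maximum likelihood estimator (ML-degree $1$). Then $\mathcal{M}_S$ has a parametrization (by a multipartition matrix) for which the iterative proportional scaling algorithm exhibits one-cycle convergence.
   Context: **Model.** $\mathcal{M}_S$ is the log-linear model of the $0/1$ matrix $\mathcal{A}_S$ with columns indexed by $S$ and rows $a_i$ ($i\in[m]$), $b_j$ ($j\in[n]$), where $a_i$ is the indicator vector of $\{(i,j')\in S\}$ and $b_j$ is the indicator vector of $\{(i',j)\in S\}$. Thus $\mathcal{M}_S$ is the set of positive probability vectors $p\in\mathbb{R}^S$ with $\log p\in\mathrm{rowspan}(\mathcal{A}_S)$. Its ML-degree is the number of complex critical points of $\sum_s u_s\log p_s$, for generic $u$, on the part of its Zariski closure with $\sum_s p_s=1$ and all $p_s\neq0$. ML-degree $1$ is equivalent to the MLE being a rational function of the data. **Multipartition matrices.** A multipartition matrix is a $0/1$ matrix whose rows are partitioned into an ordered list of blocks $A^1,\dots,A^p$ such that each column has exactly one $1$ in each block. It parametrizes $\mathcal{M}_S$ if its columns are indexed by $S$ and its row span equals that of $\mathcal{A}_S$. **Iterative proportional scaling (IPS).** Let $A$ be a multipartition matrix with blocks $A^1,\dots,A^p$ and columns indexed by $S$, and let $u$ be a vector of positive data with sum $u_+$. Start from the uniform distribution $p^{(0)}$ on $S$. At step $\ell=1,\dots,p$ set $p^{(\ell)}_s=p^{(\ell-1)}_s\cdot\dfrac{(A^\ell u)_{i}}{u_+\,(A^\ell p^{(\ell-1)})_{i}}$,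 where $i$ is the row of the block $A^\ell$ in which column $s$ has its $1$. One pass through all the blocks is a cycle, and the cycles are then repeated. IPS exhibits one-cycle convergence for $A$ if for all data $u$ the vector $p^{(p)}$ obtained after the first cycle equals the exact maximum likelihood estimate of $u$ in the model. *)

(* Defs.v *)
From HB Require Import structures.
From mathcomp Require Import all_boot all_order all_algebra.
From mathcomp Require Import all_classical all_reals all_analysis.
From mathcomp Require Import complex.
(* The notations of mpoly clash with those of mathcomp-analysis. *)
From mathcomp Require Import -(notations) mpoly.

Set Implicit Arguments.
Unset Strict Implicit.
Unset Printing Implicit Defensive.

Import Order.TTheory GRing.Theory Num.Theory.
Local Open Scope classical_set_scope.
Local Open Scope ring_scope.

(* R^S and C^S are the spaces of column vectors of length #|S|; coordinate k
   stands for the cell enum_val k of S. *)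
Section QuasiIndependence.
Variables (R : realType) (m n : nat) (S : {set 'I_m * 'I_n}).

Definition A_S : 'M[R]_(m + n, #|S|) :=
  col_mx (\matrix_(i < m, k < #|S|) ((enum_val k).1 == i)%:R)
         (\matrix_(j < n, k < #|S|) ((enum_val k).2 == j)%:R).

Definition model : set 'cV[R]_#|S| :=
  [set p : 'cV[R]_#|S| |
     [/\ forall k, 0 < p k 0,
         \sum_k p k 0 = 1 &
         ((map_mx (@ln R) p)^T <= A_S)%MS]].

Definition log_likelihood (u p : 'cV[R]_#|S|) : R :=
  \sum_k u k 0 * ln (p k 0).

Definition is_mle (u p : 'cV[R]_#|S|) : Prop :=
  model p /\
  forall q : 'cV[R]_#|S|, model q -> log_likelihood u q <= log_likelihood u p.

Definition eval_at (f : mpoly #|S| R[i]) (p : 'cV[R[i]]_#|S|) : R[i] :=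
  meval (fun k => p k 0) f.

Definition vanishing_ideal : set (mpoly #|S| R[i]) :=
  [set f : mpoly #|S| R[i] |
     forall q : 'cV[R]_#|S|, model q -> eval_at f (map_mx (real_complex R) q) = 0].

Definition zariski_closure : set 'cV[R[i]]_#|S| :=
  [set p : 'cV[R[i]]_#|S| |
     forall f, vanishing_ideal f -> eval_at f p = 0].

(* The polynomial \sum_k 'X_k - 1 is in the vanishing ideal, so that tangent
   vectors have coordinate sum 0. *)
Definition tangent_space (p : 'cV[R[i]]_#|S|) : set 'cV[R[i]]_#|S| :=
  [set v : 'cV[R[i]]_#|S| |
     forall f, vanishing_ideal f ->
       \sum_k eval_at (mderiv k f) p * v k 0 = 0].

(* The gradient of \sum_k u_k log p_k is (u_k / p_k)_k, whichever local branch
   of the complex logarithm is used. *)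
Definition critical_points (u : 'cV[R[i]]_#|S|) : set 'cV[R[i]]_#|S| :=
  [set p : 'cV[R[i]]_#|S| |
     [/\ zariski_closure p,
         \sum_k p k 0 = 1,
         forall k, p k 0 != 0 &
         forall v, tangent_space p v -> \sum_k u k 0 / p k 0 * v k 0 = 0]].

(* Generic data: all u outside the zero set of some nonzero polynomial. *)
Definition has_ml_degree (d : nat) : Prop :=
  exists2 g : mpoly #|S| R[i], g != 0 &
    forall u, eval_at g u != 0 -> (critical_points u #= `I_d)%card.

End QuasiIndependence.

(* A matrix whose rows are partitioned into blocks is given by the family of
   its blocks; the whole matrix is \mxcol_l A l. *)
Definition multipartition (R : realType) (N b : nat) (r : 'I_b -> nat)
    (A : forall l, 'M[R]_(r l, N)) : Prop :=
  forall l, (forall i k, (A l i k == 0) || (A l i k == 1)) /\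
            (forall k, exists! i, A l i k = 1).

Definition parametrizes (R : realType) (m n : nat) (S : {set 'I_m * 'I_n})
    (b : nat) (r : 'I_b -> nat) (A : forall l, 'M[R]_(r l, #|S|)) : Prop :=
  ((\mxcol_l A l) == A_S R S)%MS.

Section IPS.
Variables (R : realType) (N : nat).

Definition ips_step (r : nat) (B : 'M[R]_(r, N)) (u p : 'cV[R]_N) : 'cV[R]_N :=
  \col_k if [pick i | B i k == 1] is Some i then
           p k 0 * ((B *m u) i 0 / ((\sum_t u t 0) * (B *m p) i 0))
         else p k 0.

Variables (b : nat) (r : 'I_b -> nat) (A : forall l, 'M[R]_(r l, N)).

Definition ips_cycle (u p : 'cV[R]_N) : 'cV[R]_N :=
  foldl (fun q l => ips_step (A l) u q) p (enum 'I_b).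

Definition ips (u : 'cV[R]_N) (c : nat) : 'cV[R]_N :=
  iter c (ips_cycle u) (const_mx N%:R^-1).

End IPS.

Definition one_cycle_convergence (R : realType) (m n : nat)
    (S : {set 'I_m * 'I_n}) (b : nat) (r : 'I_b -> nat)
    (A : forall l, 'M[R]_(r l, #|S|)) : Prop :=
  forall u : 'cV[R]_#|S|, (forall k, 0 < u k 0) -> is_mle u (ips A u 1).

(* Main.v *)
(* ML-degree one forces the bipartite graph of [S] to have no induced domino
   (a 6-cycle with exactly one chord) and no induced cycle of length at least
   6.  On each of these graphs one can write down two distinct real points
   [(x_i y_j)], with signs, having equal margins and at which the margin map is
   nonsingular.  Giving the remaining vertices weights that are successive
   powers of a small parameter makes the margin equations of the whole graph a
   perturbation of a triangular system over the subgraph, so a Newton argument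
   carries the two points over to the whole graph for all data in an open set;
   these data have two critical points.

   Without dominoes, the traces on a row [N r] of the other rows form a laminar
   family, and without long induced cycles a function on [S] is of the form
   [al i + be j] as soon as it is additive on rectangles.  The blocks are the
   row partition, followed, for every trace [T] in decreasing order of size, by
   the partition of [common T * T] along the maximal traces strictly inside [T].
   Every such step fixes the conditional distribution of the column inside [T]
   and does not disturb the masses already fitted. *)
Require Import Defs.
From mathcomp Require Import -(notations) mpoly.
From HB Require Import structures.
From mathcomp Require Import all_boot all_order all_algebra.
From mathcomp Require Import all_classical all_reals all_analysis.
From mathcomp Require Import complex ring lra.

Set Implicit Arguments.
Unset Strict Implicit.
Unset Printing Implicit Defensive.

Import Order.TTheory GRing.Theory Num.Theory.
Local Open Scope ring_scope.

(** * Perturbation of quadratic systems *)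

(** The critical equations of an induced subgraph are not among those of [S], since outer vertices
    contribute to the margins of inner ones. Hence the passage to a limit in which the outer weights
    of the component tend to 0. An open set of data is required because the ML-degree only controls
    generic [u]; a real box is Zariski dense, so it meets every nonempty Zariski open set. Signed
    points are admissible because critical points live on the Zariski closure of the model. Vertex
    weights carry one scaling freedom per connected component, balanced by one linear relation
    between the margins of that component; freezing one vertex per component removes both.

    In the scaling algorithm, a step at [T] multiplies the entries of [common T * T] by a function
    of the column. The current table has rank one there, so the mass in [T] of every row of
    [common T] is multiplied by one common factor, which is 1 because the total mass of
    [common T * T] is already right. *)

HB.instance Definition _ (R : realType) (m n : nat) := Complete.on 'M[R]_(m, n).

Section QuadraticPerturbation.
Variables (R : realType) (N : nat).
Implicit Types (z h k b : 'cV[R]_N) (C : 'M[R]_N).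

Let l1 C := \sum_i \sum_j `|C i j|.

Let normr_coord h i : `|h i 0| <= `|h|.
Proof.
rewrite [`|h|]mx_normrE; exact: (le_bigmax _ (fun ij : 'I_N * 'I_1 => `|h ij.1 ij.2|) (i, 0)).
Qed.

Let normr_le_coord h (e : R) : 0 <= e -> (forall i, `|h i 0| <= e) -> `|h| <= e.
Proof.
move=> e0 he; rewrite [`|h|]mx_normrE; apply/bigmax_leP; split => // -[i j] _ /=.
by rewrite (ord1 j).
Qed.

Let l1_ge0 C : 0 <= l1 C.
Proof. by apply: sumr_ge0 => i _; apply: sumr_ge0. Qed.

Let normr_mulmx C h i : `|(C *m h) i 0| <= l1 C * `|h|.
Proof.
rewrite mxE (le_trans (ler_norm_sum _ _ _))//.
apply: (@le_trans _ _ (\sum_j `|C i j| * `|h|)).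
  by apply: ler_sum => j _; rewrite normrM ler_wpM2l.
rewrite -mulr_suml ler_wpM2r// /l1 [leRHS](bigD1 i)//= lerDl.
by apply: sumr_ge0 => ? _; apply: sumr_ge0.
Qed.

(** The margin equations in the vertex weights have this form. The constant [k] accommodates frozen
    vertices: a zero row of [C] with [k = 1] turns an equation into [z i = b i]. *)
Definition quad_map C k z : 'cV[R]_N := \col_i (z i 0 * (C *m z + k) i 0).

(* Newton's method with the derivative frozen at [z0] is a contraction near
   [z0], uniformly in the perturbed coefficients. *)
Lemma quad_map_perturbation z0 C0 k (eta : R) :
  0 < eta ->
  (forall h, (forall i, h i 0 * (C0 *m z0 + k) i 0 + z0 i 0 * (C0 *m h) i 0 = 0) ->
     h = 0) ->
  exists2 d : R, 0 < d & forall C b,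
    \sum_i \sum_j `|C i j - C0 i j| <= d ->
    (forall i, `|b i 0 - quad_map C0 k z0 i 0| <= d) ->
    exists2 z : 'cV[R]_N, (forall i, `|z i 0 - z0 i 0| <= eta) & quad_map C k z = b.
Proof.
move=> eta0 inj.
(* [J] is the derivative of [quad_map C0 k] at [z0]; by [inj] its kernel is trivial. *)
pose J : 'M[R]_N := \matrix_(i, j) ((i == j)%:R * (C0 *m z0 + k) i 0 + z0 i 0 * C0 i j).
have JE h i : (J *m h) i 0 = h i 0 * (C0 *m z0 + k) i 0 + z0 i 0 * (C0 *m h) i 0.
  rewrite mxE; under eq_bigr do rewrite mxE mulrDl.
  rewrite big_split/= (bigD1 i)//= eqxx mul1r big1 ?addr0; last first.
    by move=> j ji; rewrite eq_sym (negbTE ji) mul0r mul0r.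
  rewrite mulrC; congr (_ + _); rewrite [(C0 *m h) i 0]mxE mulr_sumr.
  by apply: eq_bigr => j _; rewrite mulrA.
have Junit : J \in unitmx.
  rewrite -unitmx_tr -row_free_unit; apply/row_freeP.
  have : kermx J^T = 0.
    apply/row_matrixP => i; rewrite row0; apply: trmx_inj; rewrite trmx0.
    apply: inj => j; rewrite -JE.
    have : J *m (row i (kermx J^T))^T = (row i (kermx J^T *m J^T))^T.
      by rewrite row_mul trmx_mul trmxK.
    by rewrite mulmx_ker row0 trmx0 => ->; rewrite mxE.
  move/eqP; rewrite kermx_eq0 => /row_freeP.
  by [].
pose B := invmx J.
pose be := l1 B + 1; pose c := l1 C0 + 1; pose ze := `|z0| + 1.
have be0 : 0 < be by rewrite ltr_wpDl.
have c0 : 0 < c by rewrite ltr_wpDl.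
have ze1 : 1 <= ze by rewrite lerDr.
have ze0 : 0 < ze by rewrite (lt_le_trans ltr01).
(* [rho] and [d] make [be * c * rho] and [be * ze * d] at most 1/8, which gives the Newton map the
   Lipschitz constant 2 * (1/8 + 1/8) = 1/2, and let it move the centre [z0] by at most [rho / 2].
   Hence the ball of radius [rho] is stable. *)
pose rho := Num.min 1 (Num.min eta (8 * be * c)^-1).
have rho0 : 0 < rho by rewrite !lt_min ltr01 eta0 invr_gt0 !mulr_gt0.
have rho1 : rho <= 1 by rewrite ge_min lexx.
have rhoeta : rho <= eta by rewrite !ge_min lexx orbT.
have rhoc : be * c * rho <= 8^-1.
  have : rho <= (8 * be * c)^-1 by rewrite !ge_min lexx !orbT.
  rewrite -mulrA invfM -(ler_pM2l (mulr_gt0 be0 c0)) => /le_trans; apply.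
  by rewrite mulrCA mulfV ?mulr1// mulf_neq0// gt_eqF.
pose d := Num.min (8 * be * ze)^-1 (rho / (2 * be * (ze ^+ 2 + 1))).
have d0 : 0 < d.
  rewrite lt_min; apply/andP; split; first by rewrite invr_gt0 !mulr_gt0.
  by rewrite divr_gt0// !mulr_gt0// addr_gt0// exprn_gt0.
exists d => // C b Cd bd.
have dz : be * ze * d <= 8^-1.
  have : d <= (8 * be * ze)^-1 by rewrite !ge_min lexx.
  rewrite -mulrA invfM -(ler_pM2l (mulr_gt0 be0 ze0)) => /le_trans; apply.
  by rewrite mulrCA mulfV ?mulr1// mulf_neq0// gt_eqF.
have drho : be * (ze ^+ 2 * d + d) <= rho / 2.
  have : d <= rho / (2 * be * (ze ^+ 2 + 1)) by rewrite !ge_min lexx orbT.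
  have w0 : 0 < be * (ze ^+ 2 + 1) by rewrite mulr_gt0// addr_gt0 ?exprn_gt0.
  rewrite -(ler_pM2l w0); have -> : be * (ze ^+ 2 + 1) * d = be * (ze ^+ 2 * d + d) by ring.
  move/le_trans; apply; rewrite le_eqVlt; apply/orP; left; apply/eqP.
  have w1 : ze ^+ 2 + 1 != 0 by rewrite gt_eqF// addr_gt0 ?exprn_gt0.
  by field; rewrite w1 gt_eqF.
pose T z := z - B *m (quad_map C k z - b).
have CmE y : C *m y = C0 *m y + (C - C0) *m y by rewrite -mulmxDl addrC subrK.
have l1d : l1 (C - C0) <= d.
  apply: le_trans Cd; rewrite le_eqVlt; apply/orP; left; apply/eqP.
  by apply: eq_bigr => i _; apply: eq_bigr => j _; rewrite !mxE.
have normB h (e : R) : 0 <= e -> (forall i, `|h i 0| <= e) -> `|B *m h| <= be * e.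
  move=> e0 he; apply: normr_le_coord => [|i]; first by rewrite mulr_ge0// ltW.
  apply: le_trans (normr_mulmx _ _ _) _; apply: ler_pM => //.
    by rewrite lerDl.
  exact: normr_le_coord.
have Dball z i : `|z - z0| <= rho -> `|z i 0| <= ze.
  move=> zz; rewrite -(subrK z0 z) mxE (le_trans (ler_normD _ _))// addrC lerD//.
  by rewrite (le_trans (normr_coord _ _))// (le_trans zz).
have contr z z' : `|z - z0| <= rho -> `|z' - z0| <= rho ->
    `|T z - T z'| <= 2^-1 * `|z - z'|.
  move=> zr zr'; pose h := z - z'.
  have TE : T z - T z' = B *m (J *m h - (quad_map C k z - quad_map C k z')).
    rewrite mulmxBr mulKmx// /T !mulmxBr /h.
    by apply/matrixP => i j; rewrite !mxE; ring.
  have h0 : 0 <= `|h| by [].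
  have cle : l1 C0 <= c by rewrite lerDl.
  rewrite TE -/h; apply: (@le_trans _ _ (be * (2 * (c * rho + ze * d) * `|h|))); last first.
    have -> : be * (2 * (c * rho + ze * d) * `|h|) =
              2 * (be * c * rho + be * ze * d) * `|h| by ring.
    by rewrite ler_wpM2r//; lra.
  apply: normB => [|i]; first by rewrite !mulr_ge0// addr_ge0// mulr_ge0// ltW.
  (* The main linear terms cancel: every remaining product has a factor [z - z0], [z' - z0] or
     [C - C0]. *)
  have -> : (J *m h - (quad_map C k z - quad_map C k z')) i 0 =
     h i 0 * ((C0 *m (z0 - z)) i 0 - ((C - C0) *m z) i 0)
     - ((z' - z0) i 0 * (C0 *m h) i 0) - z' i 0 * ((C - C0) *m h) i 0.
    have subE (a a' : 'cV[R]_N) : (a - a') i 0 = a i 0 - a' i 0 by rewrite !mxE.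
    have qE C' y : quad_map C' k y i 0 = y i 0 * (C' *m y + k) i 0 by rewrite mxE.
    rewrite ![in LHS]subE JE !qE.
    rewrite !CmE /h !mulmxBr.
    move: (C0 *m z0) (C0 *m z) (C0 *m z') ((C - C0) *m z) ((C - C0) *m z').
    move=> a1 a2 a3 a4 a5.
    rewrite !mxE; ring.
  have zz : `|z0 - z| <= rho by rewrite distrC.
  have hi : `|h i 0| <= `|h| by exact: normr_coord.
  have e1 : `|(C0 *m (z0 - z)) i 0| <= c * rho.
    by rewrite (le_trans (normr_mulmx _ _ _))// ler_pM.
  have e2 : `|((C - C0) *m z) i 0| <= d * ze.
    rewrite (le_trans (normr_mulmx _ _ _))// ler_pM//.
    by apply: normr_le_coord => [|j]; [exact: ltW|exact: Dball].
  have e3 : `|(z' - z0) i 0| <= rho by rewrite (le_trans (normr_coord _ _)).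
  have e4 : `|(C0 *m h) i 0| <= c * `|h|.
    by rewrite (le_trans (normr_mulmx _ _ _))// ler_pM.
  have e5 : `|z' i 0| <= ze by exact: Dball.
  have e6 : `|((C - C0) *m h) i 0| <= d * `|h|.
    by rewrite (le_trans (normr_mulmx _ _ _))// ler_pM.
  have -> : 2 * (c * rho + ze * d) * `|h| =
      `|h| * (c * rho + d * ze) + rho * (c * `|h|) + ze * (d * `|h|) by ring.
  apply: le_trans (ler_normB _ _) _; apply: lerD; last by rewrite normrM ler_pM.
  apply: le_trans (ler_normB _ _) _; apply: lerD; last by rewrite normrM ler_pM.
  rewrite normrM ler_pM// (le_trans (ler_normB _ _))// lerD//.
have self z : `|z - z0| <= rho -> `|T z - z0| <= rho.
  move=> zr; have -> : T z - z0 = (T z - T z0) + (T z0 - z0) by rewrite addrA subrK.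
  have z0r : `|z0 - z0| <= rho by rewrite subrr normr0 ltW.
  apply: le_trans (ler_normD _ _) _.
  have -> : rho = 2^-1 * rho + rho / 2 by lra.
  apply: lerD; first by rewrite (le_trans (contr _ _ _ _))// ler_wpM2l.
  apply: le_trans drho.
  have -> : T z0 - z0 = - (B *m (quad_map C k z0 - b)) by rewrite /T addrAC subrr add0r.
  rewrite normrN; apply: normB => [|i].
    by rewrite addr_ge0// ?mulr_ge0// ltW// ?exprn_gt0.
  have -> : (quad_map C k z0 - b) i 0 =
      z0 i 0 * ((C - C0) *m z0) i 0 - (b i 0 - quad_map C0 k z0 i 0).
    rewrite mxE [(- b) i 0]mxE !(mxE _ (fun i _ => _ i 0 * _)) CmE.
    move: (C0 *m z0) ((C - C0) *m z0) => a1 a2; rewrite !mxE; ring.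
  apply: le_trans (ler_normB _ _) _; rewrite lerD// normrM.
  have -> : ze ^+ 2 * d = ze * (d * ze) by ring.
  rewrite ler_pM//; first exact: Dball.
  rewrite (le_trans (normr_mulmx _ _ _))// ler_pM//.
  by rewrite lerDl.
pose U := [set z : 'cV[R]_N | `|z - z0| <= rho]%classic.
have funT : set_fun U U T by move=> z; exact: self.
have [|||z Uz zE] := @banach_fixed_point R 'cV[R]_N U (mkfun funT).
- exists (2^-1)%:nng; split => /=; first by rewrite invf_lt1// ltr1n.
  by move=> [z z'] [/= Uz Uz']; exact: contr.
- have -> : U = closed_ball (z0 : ('cV[R]_N : normedModType R)) rho.
    rewrite closed_ballE// /closed_ball_ /U.
    by apply/seteqP; split => z /=; rewrite distrC.
  exact: closed_ball_closed.
- by exists z0; rewrite /U/= subrr normr0 ltW.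
exists z => [i|].
  by have := normr_coord (z - z0) i; rewrite !mxE => /le_trans; apply; rewrite (le_trans Uz).
have : B *m (quad_map C k z - b) = 0.
  by apply/eqP; rewrite -oppr_eq0 -(inj_eq (addrI z)) addr0 [X in X == _](esym zE).
move/(congr1 (mulmx J)); rewrite mulKVmx// mulmx0 => /eqP; rewrite subr_eq0 => /eqP.
by [].
Qed.
End QuadraticPerturbation.

Section Perturbation.
Variables (R : realType) (V : finType).

Lemma quad_system_perturbation (z0 k : V -> R) (C0 : V -> V -> R) (eta : R) :
  0 < eta ->
  (forall h : V -> R,
     (forall v, h v * (\sum_w C0 v w * z0 w + k v) + z0 v * \sum_w C0 v w * h w = 0) ->
     forall v, h v = 0) ->
  exists2 d : R, 0 < d & forall (C : V -> V -> R) (b : V -> R),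
    (forall v w, `|C v w - C0 v w| <= d) ->
    (forall v, `|b v - z0 v * (\sum_w C0 v w * z0 w + k v)| <= d) ->
    exists2 z : V -> R, (forall v, `|z v - z0 v| <= eta) &
      forall v, z v * (\sum_w C v w * z w + k v) = b v.
Proof.
move=> eta0 inj.
pose cv (f : V -> R) : 'cV[R]_#|V| := \col_i f (enum_val i).
pose mx (C : V -> V -> R) : 'M[R]_#|V| := \matrix_(i, j) C (enum_val i) (enum_val j).
have mxE' C (f : 'cV[R]_#|V|) i :
    (mx C *m f) i 0 = \sum_w C (enum_val i) w * f (enum_rank w) 0.
  rewrite mxE (reindex (@enum_rank V)) /=; last exact/onW_bij/enum_rank_bij.
  by apply: eq_bigr => w _; rewrite !mxE enum_rankK.
have mxcvE C f i : (mx C *m cv f) i 0 = \sum_w C (enum_val i) w * f w.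
  by rewrite mxE'; apply: eq_bigr => w _; rewrite mxE enum_rankK.
have addE (x y : 'cV[R]_#|V|) i : (x + y) i 0 = x i 0 + y i 0 by rewrite mxE.
have cvE f i : (cv f) i 0 = f (enum_val i) by rewrite mxE.
have [|d d0 H] := @quad_map_perturbation R #|V| (cv z0) (mx C0) (cv k) eta eta0.
  move=> h hE; apply/matrixP => i j; rewrite (ord1 j) [RHS]mxE -(enum_valK i).
  apply: (inj (fun v => h (enum_rank v) 0)) => v.
  by have := hE (enum_rank v); rewrite addE mxcvE mxE' !cvE enum_rankK.
(* Converts an entrywise bound into a bound on the sum of all [#|V| ^ 2] entries; the added 1 keeps
   the divisor positive. *)
pose c := (#|V|%:R ^+ 2 + 1 : R).
have c1 : 1 <= c by rewrite lerDr exprn_ge0.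
have c0 : 0 < c by rewrite (lt_le_trans ltr01).
exists (d / c) => [|C b Cd bd]; first by rewrite divr_gt0.
have dcd : d / c <= d by rewrite ler_pdivrMr// ler_peMr// ltW.
have [|i|z zz zE] := H (mx C) (cv b).
- apply: (@le_trans _ _ (\sum_(i < #|V|) \sum_(j < #|V|) (d / c))).
    by apply: ler_sum => i _; apply: ler_sum => j _; rewrite !mxE.
  have -> : \sum_(i < #|V|) \sum_(j < #|V|) (d / c) = d / c * #|V|%:R ^+ 2.
    by rewrite !sumr_const !card_ord -mulrnA -[LHS]mulr_natr natrM expr2.
  rewrite mulrAC ler_pdivrMr; last exact: c0.
  by rewrite ler_wpM2l ?(ltW d0)// /c lerDl.
- rewrite cvE; have -> : quad_map (mx C0) (cv k) (cv z0) i 0 =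
    z0 (enum_val i) * (\sum_w C0 (enum_val i) w * z0 w + k (enum_val i)).
    by rewrite mxE addE mxcvE !cvE.
  exact: le_trans (bd _) _.
exists (fun v => z (enum_rank v) 0) => [v|v].
  by have := zz (enum_rank v); rewrite cvE enum_rankK.
move/matrixP/(_ (enum_rank v) 0): zE; rewrite mxE addE mxE' !cvE !enum_rankK.
by [].
Qed.

Lemma nonzero_bounded_below (f : V -> R) : (forall v, f v != 0) ->
  exists2 d : R, 0 < d & forall v, d <= `|f v|.
Proof.
move=> f0; exists (\big[Num.min/1]_v `|f v|).
  apply: (big_ind (fun x => 0 < x)) => // [x y x0 y0|v _]; first by rewrite lt_min x0.
  by rewrite normr_gt0.
by move=> v; exact: (bigmin_le_cond _ (fun v => `|f v|)).
Qed.

(* The levels [a] are distinct outside [B]: a vertex not directly attached to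
   [B] has a unique neighbour of lowest level. *)
Lemma attachment_levels (e : rel V) (B : {set V}) :
  (forall v, exists2 w, w \in B & connect e w v) -> symmetric e ->
  exists a : V -> nat,
    [/\ forall v, (a v == 0%N) = (v \in B),
        forall v w, v \notin B -> a v = a w -> v = w &
        forall v, v \notin B -> exists2 w, e v w & (a w < a v)%N].
Proof.
move=> cB es.
pose layer k := iter k (fun X : {set V} => X :|: [set v | [exists w in X, e w v]]) B.
have layerE v : exists k, v \in layer k.
  have [w wB /connectP[p]] := cB v.
  elim/last_ind: p v => [v _ ->|p u IH v]; first by exists 0%N.
  rewrite rcons_path last_rcons => /andP[/IH/(_ erefl)[k lk] eu ->].
  exists k.+1; rewrite /layer iterS -/(layer k) !inE; apply/orP; right.
  by apply/existsP; exists (last w p); rewrite lk.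
pose d v := ex_minn (layerE v).
have d0 v : (d v == 0%N) = (v \in B).
  rewrite /d; case: ex_minnP => -[|k] kv kmin; first by rewrite eqxx.
  by apply/esym/negbTE/negP => vB; have := kmin 0%N vB.
have dS v : v \notin B -> exists2 w, e v w & (d w < d v)%N.
  rewrite -d0 {1 3}/d; case: ex_minnP => -[//|k] kv kmin _.
  move: kv; rewrite /layer iterS -/(layer k) !inE => /orP[/kmin|]; first by rewrite ltnn.
  move=> /existsP[w /andP[wk ew]]; exists w; first by rewrite es.
  by rewrite /d; case: ex_minnP => l _; apply.
(* Graph distance to [B], with ties broken by the rank of the vertex; distance still dominates. *)
pose a v := if v \in B then 0%N else (d v * #|V| + enum_rank v)%N.
have V0 (v : V) : (0 < #|V|)%N by apply/card_gt0P; exists v.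
have dpos v : v \notin B -> (0 < d v)%N by rewrite -d0 lt0n.
have apos v : v \notin B -> (0 < a v)%N.
  by move=> vB; rewrite /a (negbTE vB) ltn_addr// muln_gt0 dpos// (V0 v).
exists a; split => [v|v w vB|v vB].
- case: (boolP (v \in B)) => vB; first by rewrite /a vB.
  by apply/negbTE; rewrite -lt0n apos.
- case: (boolP (w \in B)) => wB; first by rewrite {2}/a wB => a0; have := apos v vB; rewrite a0.
  rewrite /a (negbTE vB) (negbTE wB) => /(congr1 (modn^~ #|V|)).
  by rewrite !modnMDl !modn_small// => /val_inj/enum_rank_inj.
- have [w evw dw] := dS v vB; exists w => //.
  case: (boolP (w \in B)) => wB; first by rewrite {1}/a wB apos.
  rewrite /a (negbTE vB) (negbTE wB).
  have : (d w * #|V| + enum_rank w < (d w).+1 * #|V|)%N by rewrite mulSn addnC ltn_add2r.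
  by move=> /leq_trans; apply; rewrite (leq_trans _ (leq_addr _ _))// leq_mul2r dw orbT.
Qed.
End Perturbation.

(** * The bipartite graph of the cells *)

Section CellGraph.
Variables (R : realType) (m n : nat) (S : {set 'I_m * 'I_n}).
Notation V := ('I_m + 'I_n)%type.
Implicit Types (v w : V) (u : 'I_m * 'I_n -> R) (z : V -> R).

Definition cell_adj : rel V := fun v w =>
  match v, w with
  | inl i, inr j => (i, j) \in S
  | inr j, inl i => (i, j) \in S
  | _, _ => false
  end.

Definition edge_value u v w : R :=
  match v, w with
  | inl i, inr j => u (i, j)
  | inr j, inl i => u (i, j)
  | _, _ => 0
  end.

Definition margin u v := \sum_(w | cell_adj v w) edge_value u v w.

Definition rank_one z : 'I_m * 'I_n -> R := fun s => z (inl s.1) * z (inr s.2).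

Lemma cell_adj_sym : symmetric cell_adj.
Proof. by case=> i [j|j]. Qed.

Lemma edge_value_sym u v w : edge_value u v w = edge_value u w v.
Proof. by case: v; case: w. Qed.

Lemma edge_value_rank_one z v w : cell_adj v w -> edge_value (rank_one z) v w = z v * z w.
Proof. by case: v; case: w => //= i j _; rewrite /rank_one/= mulrC. Qed.

Lemma margin_rank_one z v : margin (rank_one z) v = z v * \sum_(w | cell_adj v w) z w.
Proof. by rewrite mulr_sumr; apply: eq_bigr => w /edge_value_rank_one. Qed.

Lemma marginB u u' v : margin (fun s => u s - u' s) v = margin u v - margin u' v.
Proof.
rewrite -sumrB; apply: eq_bigr => w _; rewrite /edge_value.
by case: v; case: w => *; rewrite ?subrr.
Qed.

(* Row and column totals agree on every union of components, so the margin
   equation at one vertex of each component is redundant. *)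
Lemma signed_sum0 (g : V -> V -> R) (K : {pred V}) :
  (forall v w, g v w = g w v) ->
  (forall v w, cell_adj v w -> (v \in K) = (w \in K)) ->
  \sum_(v in K) (if v is inl _ then 1 else -1) * \sum_(w | cell_adj v w) g v w = 0.
Proof.
move=> gs Kc; pose s v : R := if v is inl _ then 1 else -1.
suff : \sum_(v in K) s v * \sum_(w | cell_adj v w) g v w =
    - \sum_(v in K) s v * \sum_(w | cell_adj v w) g v w by rewrite -/s; lra.
rewrite -sumrN; under eq_bigr do rewrite mulr_sumr.
under [RHS]eq_bigr do rewrite -mulNr mulr_sumr.
rewrite [LHS](exchange_big_dep (fun w => w \in K))/=; last first.
  by move=> v w vK /Kc <-.
apply: eq_bigr => v vK; rewrite (eq_bigl (fun w => cell_adj v w)); last first.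
  move=> w; rewrite cell_adj_sym; case: (boolP (cell_adj v w)) => [/Kc <-|]; first by rewrite vK.
  by rewrite andbF.
apply: eq_bigr => w vw; rewrite gs; congr (_ * _).
by move: vw; rewrite /s; case: (v); case: (w) => //= *; rewrite ?opprK.
Qed.

Lemma margin_signed_sum0 u (K : {pred V}) :
  (forall v w, cell_adj v w -> (v \in K) = (w \in K)) ->
  \sum_(v in K) (if v is inl _ then 1 else -1) * margin u v = 0.
Proof. exact/signed_sum0/edge_value_sym. Qed.

(* The last clause says that the margin map of the subgraph induced on [H] has
   an injective derivative at [z], once the coordinate at [v0] is frozen to kill
   the scaling [(x, y) -> (c x, y / c)]. *)
Definition rigid_on (H : {set V}) (v0 : V) z : Prop :=
  [/\ forall v, v \in H -> z v != 0,
      forall v, v \notin H -> (exists2 w, w \in H & cell_adj v w) ->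
        \sum_(w in H | cell_adj v w) z w != 0 &
      forall h : V -> R, h v0 = 0 ->
        (forall v, v \in H -> v != v0 ->
          h v * (\sum_(w in H | cell_adj v w) z w) +
          z v * (\sum_(w in H | cell_adj v w) h w) = 0) ->
        forall v, v \in H -> h v = 0].

(** [H] lies in the component of [v0], so freezing [v0] removes the only scaling freedom, and the
    common value at [v0] gives both points the same frozen equation. The last clause compares
    products along an edge, since these are the entries of the tables. *)
Definition double_point (H : {set V}) (v0 : V) z z' : Prop :=
  [/\ v0 \in H /\ z v0 = z' v0,
      forall v, v \in H -> connect cell_adj v0 v /\ exists2 w, w \in H & cell_adj v w,
      rigid_on H v0 z /\ rigid_on H v0 z',
      forall v, v \in H -> z v * \sum_(w in H | cell_adj v w) z w =
                           z' v * \sum_(w in H | cell_adj v w) z' w &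
      exists v w, [/\ v \in H, w \in H, cell_adj v w & z v * z w != z' v * z' w]].

Section Extension.
Variables (H : {set V}) (v0 : V).
Hypotheses (v0H : v0 \in H)
  (Hconn : forall v, v \in H -> connect cell_adj v0 v)
  (Hnbr : forall v, v \in H -> exists2 w, w \in H & cell_adj v w).

Let rt v := if connect cell_adj v0 v then v0 else fingraph.root cell_adj v.
Let isroot v := rt v == v.
Let B : {set V} := H :|: [set v | isroot v].

Let csym : connect_sym cell_adj := sym_connect_sym cell_adj_sym.

Let rt_connect v : connect cell_adj (rt v) v.
Proof.
rewrite /rt; case: ifP => // _; rewrite csym; exact: connect_root.
Qed.

Let rt_eq v w : connect cell_adj v w -> rt v = rt w.
Proof.
move=> vw; rewrite /rt -(same_connect_r csym vw).
by case: ifP => // _; apply/eqP; rewrite (root_connect csym).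
Qed.

Let rt_rt v : rt (rt v) = rt v.
Proof. exact/rt_eq/rt_connect. Qed.

Let rt_v0 : rt v0 = v0.
Proof. by rewrite /rt connect0. Qed.

Let rt_H v : v \in H -> rt v = v0.
Proof. by move=> vH; rewrite -rt_v0; apply/esym/rt_eq/Hconn. Qed.

Let BH v w : v \in B -> w \in B -> cell_adj v w -> (v \in H) = (w \in H).
Proof.
wlog suff sub : v w / v \in B -> w \in B -> cell_adj v w -> v \in H -> w \in H.
  move=> vB wB vw; apply/idP/idP; first exact: sub.
  by apply: sub => //; rewrite cell_adj_sym.
move=> vB + vw vH; rewrite !inE => /orP[//|/eqP <-].
by rewrite -(rt_eq (connect1 vw)) rt_H.
Qed.

(** [a v] is the exponent of the small parameter at [v] and [b v] the least exponent among its
    neighbours, so the margin at a non-root has order [a v + b v]. The roots [isr], one per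
    component, carry no margin equation; the last clause justifies this. The clauses on level 0 keep
    roots outside [H] from interfering with [H]. *)
Lemma level_structure : exists a b : V -> nat, exists isr : pred V,
  [/\ [/\ isr v0, forall v, v \in H -> isr v -> v = v0 &
          forall v, (a v == 0%N) = (v \in H) || isr v],
      [/\ forall v w, cell_adj v w -> ~~ isr v -> (b v <= a w)%N,
          forall v, v \in H -> ~~ isr v -> b v = 0%N &
          forall v, a v != 0%N -> (b v < a v)%N /\ exists2 w, cell_adj v w & a w = b v],
      forall v w, a v != 0%N -> a v = a w -> v = w,
      (forall v w, a v = 0%N -> a w = 0%N -> cell_adj v w -> (v \in H) = (w \in H)) /\
      (forall v w w', cell_adj v w -> cell_adj v w' -> a w = 0%N -> a w' = 0%N ->
         w' \notin H -> w = w') &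
      forall u, (forall v, ~~ isr v -> margin u v = 0) -> forall v, margin u v = 0].
Proof.
have [|a [a0 ainj anbr]] := @attachment_levels V cell_adj B _ cell_adj_sym.
  by move=> v; exists (rt v); rewrite ?rt_connect// !inE /isroot rt_rt eqxx orbT.
have inB v : (v \in B) = (v \in H) || isroot v by rewrite !inE.
have nbr v : ~~ isroot v -> exists w, cell_adj v w.
  move=> vr; have [vB|/anbr[w]] := boolP (v \in B); last by exists w.
  by move: vB; rewrite inB (negbTE vr) orbF => /Hnbr[w]; exists w.
pose b v := if [pick w | cell_adj v w] is Some w0 then
   a [arg min_(w < w0 | cell_adj v w) a w]%N else 0%N.
have bmin v w : cell_adj v w -> (b v <= a w)%N.
  move=> vw; rewrite /b; case: pickP => [w0 vw0|/(_ w)]; last by rewrite vw.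
  by case: arg_minnP => // w1 _; apply.
have bex v : ~~ isroot v -> exists2 w, cell_adj v w & a w = b v.
  move/nbr => [w vw]; rewrite /b; case: pickP => [w0 vw0|/(_ w)]; last by rewrite vw.
  by case: arg_minnP => // w1 vw1 _; exists w1.
exists a, b, isroot; split.
- split=> [|v vH|v]; [by rewrite /isroot rt_v0|by rewrite /isroot rt_H// => /eqP|].
  by rewrite a0 inB.
- split=> [v w vw _|v vH vr|v].
  + exact: bmin.
  + have [w wH vw] := Hnbr vH; apply/eqP; rewrite -leqn0 (leq_trans (bmin _ _ vw))//.
    by rewrite leqn0 a0 inB wH.
  + rewrite a0 => vB; have [w vw aw] := anbr v vB; split.
      exact: leq_ltn_trans (bmin _ _ vw) aw.
    by apply: bex; move: vB; rewrite inB negb_or => /andP[].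
- by move=> v w; rewrite a0; exact: ainj.
- split=> [v w /eqP + /eqP +|v w w' vw vw' /eqP + /eqP +].
    by rewrite !a0; exact: BH.
  rewrite !a0 => wB; rewrite inB => /orP[w'H|/eqP w'r w'H]; first by rewrite w'H.
  have rw : rt w = rt w' by rewrite -(rt_eq (connect1 vw)) (rt_eq (connect1 vw')).
  move: wB; rewrite inB => /orP[wH|/eqP <-]; last by rewrite rw.
  by move: w'H; rewrite -w'r -rw rt_H// v0H.
- move=> u u0 v; have [vr|] := boolP (isroot v); last exact: u0.
  (* In the alternating sum over the component of the root [v], all other terms vanish. *)
  have := @margin_signed_sum0 u [pred w | rt w == v].
  rewrite (bigD1 v)//= big1 ?addr0; last first.
    move=> w /andP[/= /eqP wv wv']; rewrite u0 ?mulr0//; apply/eqP => ww.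
    by move: wv'; rewrite -wv ww eqxx.
  move=> s0; have /s0/eqP : forall w w', cell_adj w w' ->
      (w \in [pred w | rt w == v]) = (w' \in [pred w | rt w == v]).
    by move=> w w' /connect1/rt_eq; rewrite !inE => ->.
  rewrite mulf_eq0 => /orP[|/eqP//].
  by case: (v) => ?; rewrite ?oppr_eq0 oner_eq0.
Qed.
End Extension.
End CellGraph.

(** * From two points on a subgraph to two solutions for an open set of data *)

Section DoublePointOpen.
Variables (R : realType) (m n : nat) (S : {set 'I_m * 'I_n}).
Notation V := ('I_m + 'I_n)%type.
Notation adj := (cell_adj S).
Implicit Types (v w : V) (u : 'I_m * 'I_n -> R) (z : V -> R).

Section Levels.
Variables (H : {set V}) (v0 : V) (a b : V -> nat) (isr : pred V).
Hypotheses (r0 : isr v0) (rH : forall v, v \in H -> isr v -> v = v0)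
  (a0 : forall v, (a v == 0%N) = (v \in H) || isr v)
  (bmin : forall v w, adj v w -> ~~ isr v -> (b v <= a w)%N)
  (bH : forall v, v \in H -> ~~ isr v -> b v = 0%N)
  (ba : forall v, a v != 0%N -> (b v < a v)%N /\ exists2 w, adj v w & a w = b v)
  (ainj : forall v w, a v != 0%N -> a v = a w -> v = w)
  (base : forall v w, a v = 0%N -> a w = 0%N -> adj v w -> (v \in H) = (w \in H))
  (base1 : forall v w w', adj v w -> adj v w' -> a w = 0%N -> a w' = 0%N ->
     w' \notin H -> w = w').

(* Substituting [e ^+ a v * z v] for [z v] and dividing the margin at [v] by
   [e ^+ (a v + b v)] gives a system with these coefficients.  At [e = 0] only
   the neighbours of lowest level survive. *)
Definition level_coef (e : R) v w : R :=
  if isr v then 0 else (adj v w)%:R * e ^+ (a w - b v).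

Let anz v : a v != 0%N -> (v \notin H) * (isr v = false).
Proof. by rewrite a0 negb_or => /andP[-> /negbTE]. Qed.

Let coef0 v w : ~~ isr v -> level_coef 0 v w = (adj v w && (a w == b v))%:R.
Proof.
move=> vr; rewrite /level_coef (negbTE vr); case: (boolP (adj v w)) => vw; last by rewrite mul0r.
by rewrite mul1r expr0n subn_eq0 eqn_leq (bmin vw vr) andbT.
Qed.

Let sum0 v z : ~~ isr v ->
  \sum_w level_coef 0 v w * z w = \sum_(w | adj v w && (a w == b v)) z w.
Proof.
move=> vr; rewrite [RHS]big_mkcond/=; apply: eq_bigr => w _; rewrite coef0//.
by case: ifP => _; rewrite ?mul1r ?mul0r.
Qed.

Lemma level_sum_base v z : v \in H -> ~~ isr v ->
  \sum_w level_coef 0 v w * z w = \sum_(w in H | adj v w) z w.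
Proof.
move=> vH vr; rewrite sum0//; apply: eq_bigl => w; rewrite (bH vH vr) andbC.
case vw: (adj v w); rewrite ?andbF ?andbT//; apply/idP/idP => [/eqP aw|wH].
  by rewrite -(base _ aw vw)//; apply/eqP; rewrite a0 vH.
by rewrite a0 wH.
Qed.

Lemma level_sum_root v z : isr v -> \sum_w level_coef 0 v w * z w = 0.
Proof. by move=> vr; rewrite big1// => w _; rewrite /level_coef vr mul0r. Qed.

(** At [e = 0] the equation at [v] involves only neighbours of level [b v], which is below that of
    [v], so it determines [z' v] once their sum is nonzero. That sum is a single nonzero value, or
    runs over the neighbours in [H] and is nonzero by [rigid_on]. The right-hand side 1 is an
    arbitrary nonzero constant, the same for both points of a double point. *)
Lemma level_extension z : rigid_on S H v0 z -> exists z',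
  [/\ forall v, v \in H -> z' v = z v,
      forall v, v \notin H -> isr v -> z' v = 1,
      forall v, a v != 0%N -> z' v * \sum_w level_coef 0 v w * z' w = 1 &
      forall v, z' v != 0].
Proof.
move=> [znz znbr _].
suff /(_ (\max_v a v)%N)[z' [z'H z'r z'a]] : forall k, exists z',
   [/\ forall v, v \in H -> z' v = z v, forall v, v \notin H -> isr v -> z' v = 1 &
      forall v, a v != 0%N -> (a v <= k)%N -> z' v * \sum_w level_coef 0 v w * z' w = 1].
  have z'a' v : a v != 0%N -> z' v * \sum_w level_coef 0 v w * z' w = 1.
    by move=> av; apply: z'a => //; exact: leq_bigmax.
  exists z'; split=> // v; have [av|av] := boolP (a v == 0%N); last first.
    by apply/eqP => zv; have /eqP := z'a' _ av; rewrite zv mul0r eq_sym oner_eq0.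
  have [vH|vH] := boolP (v \in H); first by rewrite z'H// znz.
  by rewrite z'r ?oner_eq0//; move: av; rewrite a0 (negbTE vH).
elim=> [|k [z' [z'H z'r z'a]]].
  exists (fun v => if v \in H then z v else 1); split=> [v ->//|v /negbTE ->//|v].
  by move=> /negbTE av; rewrite leqn0 av.
exists (fun v => if a v == k.+1 then (\sum_w level_coef 0 v w * z' w)^-1 else z' v).
have a0P v : (v \in H) || isr v -> (a v == k.+1) = false.
  by rewrite -a0 => /eqP ->.
split=> [v vH|v vH vr|v av ak]; [by rewrite a0P ?vH// z'H|by rewrite a0P ?vr ?orbT// z'r|].
have [vH vr] := anz av; have [bv [w vw aw]] := ba av.
have nr : ~~ isr v by rewrite vr.
have -> (y : V -> R) : \sum_w level_coef 0 v w * (if a w == k.+1 then y w else z' w) =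
    \sum_w level_coef 0 v w * z' w.
  apply: eq_bigr => w' _; case: ifP => // /eqP aw'.
  rewrite coef0// aw' [_ == b v]gtn_eqF ?andbF ?mul0r//.
  exact: leq_trans bv ak.
case: ifP => [_|/negbT avk]; last first.
  by apply: z'a => //; rewrite -ltnS ltn_neqAle avk.
apply: mulVf; rewrite sum0//.
have [bv0|bv0] := eqVneq (b v) 0%N; last first.
  rewrite (bigD1 w)/=; last by rewrite vw aw eqxx.
  rewrite big1 ?addr0; last first.
    move=> w' /andP[/andP[vw' /eqP aw'] ww']; case/eqP: ww'; apply/esym/ainj; rewrite ?aw//.
  apply/eqP => zw; have := z'a w; rewrite aw zw mul0r bv0 => /(_ isT).
  by rewrite -ltnS (leq_trans bv ak) => /(_ isT)/eqP; rewrite eq_sym oner_eq0.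
rewrite bv0 in aw *.
have [wH|wH] := boolP (w \in H).
  rewrite (eq_bigl (fun w => (w \in H) && adj v w)); last first.
    move=> w'; rewrite andbC; case vw': (adj v w'); rewrite ?andbF ?andbT//.
    have [w'H|w'H] := boolP (w' \in H); first by rewrite a0 w'H.
    apply/negbTE/eqP => aw'; have ww' := base1 vw vw' aw aw' w'H.
    by move: w'H; rewrite -ww' wH.
  rewrite (eq_bigr z); first by apply: znbr => //; exists w.
  by move=> w' /andP[w'H _]; rewrite z'H.
rewrite (bigD1 w)/=; last by rewrite vw aw eqxx.
rewrite big1 ?addr0; last first.
  move=> w' /andP[/andP[vw' /eqP aw'] ww']; case/eqP: ww'; exact: (base1 vw' vw).
by rewrite z'r ?oner_eq0//; move/eqP: aw; rewrite a0 (negbTE wH).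
Qed.

(** The derivative at [e = 0] is block triangular: [h] vanishes at the roots, then on [H] by
    rigidity, then upwards along the levels. The diagonal entry at [v] is nonzero because its
    product with [z' v] is 1. *)
Lemma level_rigid z z' : rigid_on S H v0 z ->
  (forall v, v \in H -> z' v = z v) ->
  (forall v, a v != 0%N -> z' v * \sum_w level_coef 0 v w * z' w = 1) ->
  forall h : V -> R,
    (forall v, h v * (\sum_w level_coef 0 v w * z' w + (isr v)%:R) +
               z' v * \sum_w level_coef 0 v w * h w = 0) ->
    forall v, h v = 0.
Proof.
move=> [_ _ nd] z'H z'a h hE.
have hr v : isr v -> h v = 0.
  by move=> vr; have := hE v; rewrite !level_sum_root// vr add0r mulr1 mulr0 addr0.
have hH v : v \in H -> h v = 0.
  apply: nd; first exact: hr.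
  move=> w wH wv0; have wr : ~~ isr w by apply: contraNN wv0 => /rH ->.
  have := hE w; rewrite !level_sum_base// (negbTE wr) addr0 (z'H _ wH).
  by rewrite [X in _ * X + _](eq_bigr z) => [|w' /andP[/z'H]//].
move=> v; have [k] := ubnP (a v); elim: k v => // k IH v avk.
have [|av] := boolP (a v == 0%N); first by rewrite a0 => /orP[/hH|/hr].
have [vH vr] := anz av; have [bv _] := ba av.
have := hE v; rewrite vr addr0 [X in _ + _ * X]big1 ?mulr0 ?addr0; last first.
  move=> w _; rewrite coef0 ?vr//; case: andP => [[_ /eqP aw]|_]; last by rewrite mul0r.
  by rewrite IH ?mulr0// aw; exact: leq_trans bv _.
move/eqP; rewrite mulf_eq0 => /orP[/eqP//|/eqP s0].
by have /eqP := z'a _ av; rewrite s0 mulr0 eq_sym oner_eq0.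
Qed.

End Levels.

Let near_product (x y x' y' M eta : R) : `|x - y| <= eta -> `|x' - y'| <= eta ->
  eta <= 1 -> `|y| + 1 <= M -> `|y'| <= M -> `|x * x' - y * y'| <= 2 * M * eta.
Proof.
move=> xy xy' eta1 yM yM'; have -> : x * x' - y * y' = x * (x' - y') + (x - y) * y' by ring.
have xM : `|x| <= M.
  by rewrite -(subrK y x) (le_trans (ler_normD _ _))// addrC (le_trans _ yM)// lerD2l (le_trans xy).
rewrite (le_trans (ler_normD _ _))// !normrM.
have -> : 2 * M * eta = M * eta + eta * M by ring.
by apply: lerD; apply: ler_pM.
Qed.

Lemma double_point_open (H : {set V}) (v0 : V) (z1 z2 : V -> R) :
  double_point S H v0 z1 z2 ->
  exists (u0 : 'I_m * 'I_n -> R) (d : R), 0 < d /\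
    forall u, (forall s, `|u s - u0 s| <= d) ->
    exists y1 y2 : V -> R,
      [/\ forall v, y1 v != 0 /\ y2 v != 0,
          forall v, margin S (rank_one y1) v = margin S u v,
          forall v, margin S (rank_one y2) v = margin S u v &
          exists2 s, s \in S & rank_one y1 s != rank_one y2 s].
Proof.
move=> [[v0H zv0] Hc [n1 n2] Hm [v [w [vH wH vw pne]]]].
have [a [b [isr [[r0 rH a0] [bmin bH ba] ainj [base base1] red]]]] :=
  @level_structure R m n S H v0 v0H (fun v vH => (Hc v vH).1) (fun v vH => (Hc v vH).2).
have [y1 [y1H y1r y1a y1n]] := level_extension a0 bmin ba ainj base1 n1.
have [y2 [y2H y2r y2a y2n]] := level_extension a0 bmin ba ainj base1 n2.
pose C := level_coef a b isr; pose k v : R := (isr v)%:R.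
pose f z x := z x * (\sum_w C 0 x w * z w + k x).
have f12 x : f y1 x = f y2 x.
  rewrite /f; have [xr|xr] := boolP (isr x).
    rewrite !level_sum_root// /k xr add0r !mulr1.
    have [xH|xH] := boolP (x \in H); last by rewrite y1r// y2r.
    by rewrite (rH _ xH xr) y1H// y2H.
  rewrite /k (negbTE xr) !addr0; have [xH|xH] := boolP (x \in H).
    rewrite !(level_sum_base a0 bmin bH base)// y1H// y2H//.
    rewrite (eq_bigr z1) => [|x' /andP[/y1H]//].
    by rewrite [in RHS](eq_bigr z2) => [|x' /andP[/y2H]//]; exact: Hm.
  have ax : a x != 0%N by rewrite a0 negb_or xH xr.
  by rewrite y1a// y2a.
have [d1 d10 Y1] := nonzero_bounded_below y1n.
have [d2 d20 Y2] := nonzero_bounded_below y2n.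
pose M : R := \sum_x (`|y1 x| + `|y2 x|) + 1.
have Mge x : `|y1 x| + `|y2 x| + 1 <= M.
  rewrite lerD2r (bigD1 x)//= lerDl; apply: sumr_ge0 => ? _; exact: addr_ge0.
have M1 : 1 <= M by rewrite lerDr; apply: sumr_ge0 => ? _; exact: addr_ge0.
have M0 : 0 < M by rewrite (lt_le_trans ltr01).
pose g := `|z1 v * z1 w - z2 v * z2 w|.
have g0 : 0 < g by rewrite normr_gt0 subr_eq0.
(* The first two bounds keep the perturbed coordinates away from 0; [g / (8 * M)] limits the change
   of the product along the edge [v w] to [g / 4] for each point, so the two products stay
   different. *)
pose eta := Num.min (Num.min (d1 / 2) (d2 / 2)) (Num.min 1 (g / (8 * M))).
have gM : 0 < g / (8 * M) by rewrite divr_gt0// mulr_gt0.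
have eta0 : 0 < eta by rewrite !lt_min gM ltr01 !divr_gt0.
have eta1 : eta <= 1 by rewrite !ge_min lexx !orbT.
have etag : 2 * M * eta <= g / 4.
  have : eta <= g / (8 * M) by rewrite !ge_min lexx !orbT.
  rewrite -(ler_pM2l (mulr_gt0 (ltr0n R 2) M0)) => /le_trans; apply.
  rewrite le_eqVlt; apply/orP; left; apply/eqP; field.
  by rewrite gt_eqF.
have etad1 : eta < d1.
  have : eta <= d1 / 2 by rewrite !ge_min lexx.
  by move=> ?; lra.
have etad2 : eta < d2.
  have : eta <= d2 / 2 by rewrite !ge_min lexx !orbT.
  by move=> ?; lra.
have [q1 q10 Q1] := quad_system_perturbation eta0
  (level_rigid r0 rH a0 bmin bH ba base n1 y1H y1a).
have [q2 q20 Q2] := quad_system_perturbation eta0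
  (level_rigid r0 rH a0 bmin bH ba base n2 y2H y2a).
pose d := Num.min q1 q2.
have d0 : 0 < d by rewrite lt_min q10.
have dq1 : d <= q1 by rewrite ge_min lexx.
have dq2 : d <= q2 by rewrite ge_min lexx orbT.
(* As [e <= 1], every positive power of [e] is at most [e], so [level_coef] at [e] is within [d] of
   its value at 0. *)
pose e := Num.min 1 d.
have e0 : 0 < e by rewrite lt_min ltr01.
have e1 : e <= 1 by rewrite ge_min lexx.
have ed : e <= d by rewrite ge_min lexx orbT.
have Cd x x' : `|C e x x' - C 0 x x'| <= d.
  rewrite /C /level_coef; case: ifP => _; first by rewrite subrr normr0 ltW.
  case: (adj x x'); last by rewrite !mul0r subrr normr0 ltW.
  rewrite !mul1r; case: (a x' - b x)%N => [|p]; first by rewrite !expr0 subrr normr0 ltW.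
  rewrite expr0n subr0 ger0_norm ?exprn_ge0 ?(ltW e0)//.
  by apply: le_trans ed; rewrite exprS ler_piMr ?exprn_ile1// ?(ltW e0)// exprn_ge0 ?(ltW e0).
pose sc z x := e ^+ a x * z x.
have margin_sc z x : ~~ isr x ->
    margin S (rank_one (sc z)) x = e ^+ (a x + b x) * (z x * (\sum_w C e x w * z w + k x)).
  move=> xr; rewrite margin_rank_one /sc /k (negbTE xr) addr0 exprD -!mulrA; congr (_ * _).
  rewrite mulrCA; congr (_ * _); rewrite mulr_sumr [LHS]big_mkcond/=.
  apply: eq_bigr => x' _; rewrite /C /level_coef (negbTE xr).
  case: ifP => xx'; last by rewrite mul0r mul0r mulr0.
  by rewrite mul1r mulrA -exprD subnKC// bmin.
have [|x|x0 _ x0E] := Q1 (C e) (f y1); first by move=> ? ?; exact: le_trans (Cd _ _) dq1.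
  by rewrite subrr normr0 ltW.
pose T := (\sum_x (a x + b x))%N.
pose c : R := #|{: V}|%:R + 1.
have c0 : 0 < c by rewrite ltr_wpDl.
(* A margin has fewer than [c] terms, and rescaling it at [x] divides the error by
   [e ^+ (a x + b x)], which is at least [e ^+ T]; hence this radius. *)
exists (rank_one (sc x0)), (d * e ^+ T / c); split.
  by rewrite divr_gt0// mulr_gt0// exprn_gt0.
move=> u uu.
(* Both points are perturbed towards this one right-hand side. It is unchanged at the roots, whose
   margins are recovered through [red]. *)
pose bb x := if isr x then f y1 x else margin S u x / e ^+ (a x + b x).
have bbE x : `|bb x - f y1 x| <= d.
  rewrite /bb; case: ifPn => xr; first by rewrite subrr normr0 ltW.
  have ep : 0 < e ^+ (a x + b x) by rewrite exprn_gt0.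
  have -> : f y1 x = margin S (rank_one (sc x0)) x / e ^+ (a x + b x).
    by rewrite margin_sc// x0E mulrC mulKf// gt_eqF.
  rewrite -mulrBl -marginB normrM normfV (gtr0_norm ep) ler_pdivrMr//.
  apply: (@le_trans _ _ (\sum_(x' : V) (d * e ^+ T / c))).
    apply: le_trans (ler_norm_sum _ _ _) _; rewrite big_mkcond/=.
    apply: ler_sum => x' _; case: ifP => xx'; last first.
      by rewrite divr_ge0 ?mulr_ge0 ?exprn_ge0// ltW.
    by rewrite /edge_value; case: (x) xx'; case: (x').
  rewrite sumr_const -mulr_natr mulrAC ler_pdivrMr// -!mulrA ler_wpM2l// ?(ltW d0)//.
  apply: ler_pM; rewrite ?exprn_ge0 ?(ltW e0) ?ler_wiXn2l ?(ltW e0)//; last by rewrite lerDl.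
  by rewrite /T (bigD1 x)//= leq_addr.
have [|x|x1 x1y x1E] := Q1 (C e) bb; first by move=> ? ?; exact: le_trans (Cd _ _) dq1.
  exact: le_trans (bbE x) dq1.
have [|x|x2 x2y x2E] := Q2 (C e) bb; first by move=> ? ?; exact: le_trans (Cd _ _) dq2.
  by rewrite -/(f y2 x) -f12; exact: le_trans (bbE x) dq2.
have en p : e ^+ p != 0 by rewrite expf_neq0// gt_eqF.
have mE z : (forall x, z x * (\sum_w C e x w * z w + k x) = bb x) ->
    forall x, margin S (rank_one (sc z)) x = margin S u x.
  move=> zE x; apply/eqP; rewrite -subr_eq0 -marginB; apply/eqP; move: x; apply: red => x xr.
  by rewrite marginB margin_sc// zE /bb (negbTE xr) mulrC divfK// subrr.
exists (sc x1), (sc x2); split; [|exact: mE|exact: mE|].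
- move=> x; rewrite !mulf_neq0//.
    by apply/eqP => x20; have := Y2 x; have := x2y x; rewrite x20 sub0r normrN; lra.
  by apply/eqP => x10; have := Y1 x; have := x1y x; rewrite x10 sub0r normrN; lra.
have ne : x1 v * x1 w != x2 v * x2 w.
  have N1 : `|x1 v * x1 w - z1 v * z1 w| <= 2 * M * eta.
    rewrite -y1H// -y1H//; apply: near_product => //.
      by have := Mge v; have := normr_ge0 (y2 v); lra.
    by have := Mge w; have := normr_ge0 (y2 w); lra.
  have N2 : `|x2 v * x2 w - z2 v * z2 w| <= 2 * M * eta.
    rewrite -y2H// -y2H//; apply: near_product => //.
      by have := Mge v; have := normr_ge0 (y1 v); lra.
    by have := Mge w; have := normr_ge0 (y1 w); lra.
  apply/eqP => x12; have : g <= `|x2 v * x2 w - z2 v * z2 w| + `|x1 v * x1 w - z1 v * z1 w|.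
    rewrite /g; have -> : z1 v * z1 w - z2 v * z2 w =
      (x2 v * x2 w - z2 v * z2 w) - (x1 v * x1 w - z1 v * z1 w) by rewrite x12; ring.
    exact: ler_normB.
  by lra.
have sE z x y : sc z x * sc z y = e ^+ a x * e ^+ a y * (z x * z y) by rewrite /sc; ring.
have ne' : sc x1 v * sc x1 w != sc x2 v * sc x2 w.
  by rewrite !sE (inj_eq (mulfI _)) ?mulf_neq0.
case: (v) (w) vw ne' => i [j|j]//= ij ne'; first by exists (i, j).
by exists (j, i) => //; rewrite /rank_one/= mulrC [X in _ != X]mulrC.
Qed.

End DoublePointOpen.

(** * Dominoes and induced cycles *)

Section DoublePoints.
Variables (R : realType) (m n : nat) (S : {set 'I_m * 'I_n}).
Notation V := ('I_m + 'I_n)%type.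
Notation adj := (cell_adj S).

Definition rigid_pattern (h : nat) (psi : 'I_h -> V) (i0 : 'I_h) (t : 'I_h -> R) : Prop :=
  [/\ forall i, t i != 0,
      forall v, (exists i, adj v (psi i)) -> \sum_(i | adj v (psi i)) t i != 0 &
      forall l : 'I_h -> R, l i0 = 0 ->
        (forall i, i != i0 ->
          l i * (\sum_(j | adj (psi i) (psi j)) t j) +
          t i * (\sum_(j | adj (psi i) (psi j)) l j) = 0) ->
        forall i, l i = 0].

Lemma double_point_pattern (h : nat) (psi : 'I_h -> V) (i0 : 'I_h) (t t' : 'I_h -> R) :
  injective psi -> t i0 = t' i0 ->
  (forall i, connect adj (psi i0) (psi i) /\ exists j, adj (psi i) (psi j)) ->
  rigid_pattern psi i0 t -> rigid_pattern psi i0 t' ->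
  (forall i, t i * (\sum_(j | adj (psi i) (psi j)) t j) =
             t' i * (\sum_(j | adj (psi i) (psi j)) t' j)) ->
  (exists i j, adj (psi i) (psi j) /\ t i * t j != t' i * t' j) ->
  exists H v0 z z', @double_point R m n S H v0 z z'.
Proof.
move=> psi_inj t0 cn rt rt' mt [i [j [ij tij]]].
pose H : {set V} := [set psi i | i in 'I_h].
pose ext (t : 'I_h -> R) v := \sum_(i | psi i == v) t i.
have extE s x : ext s (psi x) = s x.
  by rewrite /ext (eq_bigl (pred1 x)) ?big_pred1_eq// => y; rewrite (inj_eq psi_inj).
have HE v (F : V -> R) : \sum_(w in H | adj v w) F w = \sum_(x | adj v (psi x)) F (psi x).
  rewrite big_mkcondr/= big_imset/=; last by move=> x y _ _; exact: psi_inj.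
  by rewrite [RHS]big_mkcond/=.
have inH x : psi x \in H by exact: imset_f.
have rigid s : rigid_pattern psi i0 s -> rigid_on S H (psi i0) (ext s).
  move=> [s0 sv sl]; split.
  - by move=> _ /imsetP[x _ ->]; rewrite extE.
  - move=> v _ [_ /imsetP[x _ ->] vx]; rewrite HE; under eq_bigr do rewrite extE.
    by apply: sv; exists x.
  - move=> l l0 lE _ /imsetP[x _ ->]; apply: (sl (l \o psi)) => // y yi0.
    have := lE (psi y) (inH y); rewrite (inj_eq psi_inj) => /(_ yi0); rewrite !HE extE/=.
    by under eq_bigr do rewrite extE.
exists H, (psi i0), (ext t), (ext t'); split.
- by rewrite !extE.
- move=> _ /imsetP[x _ ->]; have [cx [y xy]] := cn x.
  by split=> //; exists (psi y).
- by split; exact: rigid.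
- move=> _ /imsetP[x _ ->]; rewrite !HE !extE.
  by under eq_bigr do rewrite extE; under [in RHS]eq_bigr do rewrite extE.
- by exists (psi i), (psi j); rewrite !extE !inH.
Qed.

(* The margin equations of the domino have two solutions; [t2] is the one
   conjugate to the constant [t1 = 1]. *)
Lemma domino_double_point (r r' r'' : 'I_m) (c c' c'' : 'I_n) :
  (r, c) \in S -> (r, c') \in S -> (r, c'') \in S ->
  (r', c) \in S -> (r', c') \in S -> (r', c'') \notin S ->
  (r'', c) \in S -> (r'', c') \notin S -> (r'', c'') \in S ->
  exists H v0 z z', @double_point R m n S H v0 z z'.
Proof.
move=> e1 e2 e3 e4 e5 /negbTE e6 e7 /negbTE e8 e9.
pose q : seq V := [:: inl r; inl r'; inl r''; inr c; inr c'; inr c''].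
have uq : uniq q.
  have rr' : r != r' by apply: contraFneq e6 => <-.
  have rr'' : r != r'' by apply: contraFneq e8 => <-.
  have r'r'' : r' != r'' by apply: contraFneq e8 => <-.
  have cc' : c != c' by apply: contraFneq e8 => <-.
  have cc'' : c != c'' by apply: contraFneq e6 => <-.
  have c'c'' : c' != c'' by apply: contraFneq e6 => <-.
  by rewrite /= !inE /= !(inj_eq inl_inj) !(inj_eq inr_inj) !negb_or rr' rr'' r'r'' cc' cc'' c'c''.
pose psi (i : 'I_6) := nth (inl r) q i.
pose t1 (i : 'I_6) : R := 1.
pose t2 (i : 'I_6) : R := nth 0 [:: 1; -2/3; -2/3; -9; 6; 6] i.
have sumE v (s : 'I_6 -> R) : \sum_(j | adj v (psi j)) s j =
   (if adj v (inl r) then s (inord 0) else 0) +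
   (if adj v (inl r') then s (inord 1) else 0) +
   (if adj v (inl r'') then s (inord 2) else 0) +
   (if adj v (inr c) then s (inord 3) else 0) +
   (if adj v (inr c') then s (inord 4) else 0) +
   (if adj v (inr c'') then s (inord 5) else 0).
  rewrite big_mkcond/= !big_ord_recl big_ord0/= addr0 !addrA.
  by do ![congr (_ + _)]; rewrite /psi/=; congr (if _ then s _ else _); apply: val_inj; rewrite /= inordK.
have psiE : (psi (inord 0) = inl r) * (psi (inord 1) = inl r') * (psi (inord 2) = inl r'') *
  (psi (inord 3) = inr c) * (psi (inord 4) = inr c') * (psi (inord 5) = inr c'').
  by rewrite /psi !inordK.
have t2E : (t2 (inord 0) = 1) * (t2 (inord 1) = -2/3) * (t2 (inord 2) = -2/3) *
  (t2 (inord 3) = -9) * (t2 (inord 4) = 6) * (t2 (inord 5) = 6).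
  by rewrite /t2 !inordK.
have all6 (P : 'I_6 -> Prop) : P (inord 0) -> P (inord 1) -> P (inord 2) -> P (inord 3) ->
    P (inord 4) -> P (inord 5) -> forall i, P i.
  move=> p0 p1 p2 p3 p4 p5 i; rewrite -(inord_val i).
  by case: i => -[|[|[|[|[|[]]]]]].
have pu : injective psi.
  move=> i j /eqP; rewrite (@nth_uniq _ _ q i j (ltn_ord i) (ltn_ord j) uq).
  by move/eqP/val_inj.
have cn i : connect adj (psi (inord 0)) (psi i) /\ exists j, adj (psi i) (psi j).
  move: i; apply: all6; rewrite !psiE; split.
  - exact: connect0.
  - by exists (inord 3); rewrite psiE.
  - by apply: (@connect_trans _ _ (inr c)); apply: connect1.
  - by exists (inord 3); rewrite psiE.
  - by apply: (@connect_trans _ _ (inr c)); apply: connect1.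
  - by exists (inord 3); rewrite psiE.
  - exact: connect1.
  - by exists (inord 0); rewrite psiE.
  - exact: connect1.
  - by exists (inord 0); rewrite psiE.
  - exact: connect1.
  - by exists (inord 0); rewrite psiE.
have adjE := (e1, e2, e3, e4, e5, e6, e7, e8, e9).
have linE (t l : 'I_6 -> R) : (forall i, i != inord 0 ->
          l i * (\sum_(j | adj (psi i) (psi j)) t j) +
          t i * (\sum_(j | adj (psi i) (psi j)) l j) = 0) ->
  [/\ l (inord 1) * (t (inord 3) + t (inord 4)) + t (inord 1) * (l (inord 3) + l (inord 4)) = 0,
      l (inord 2) * (t (inord 3) + t (inord 5)) + t (inord 2) * (l (inord 3) + l (inord 5)) = 0,
      l (inord 3) * (t (inord 0) + t (inord 1) + t (inord 2)) +
        t (inord 3) * (l (inord 0) + l (inord 1) + l (inord 2)) = 0,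
      l (inord 4) * (t (inord 0) + t (inord 1)) + t (inord 4) * (l (inord 0) + l (inord 1)) = 0 &
      l (inord 5) * (t (inord 0) + t (inord 2)) + t (inord 5) * (l (inord 0) + l (inord 2)) = 0].
  have ne k : (0 < k < 6)%N -> (inord k : 'I_6) != inord 0.
    by move=> /andP[k0 k6]; rewrite -val_eqE/= !inordK// -lt0n.
  move=> lE.
  have := lE _ (ne 5%N isT); have := lE _ (ne 4%N isT); have := lE _ (ne 3%N isT).
  have := lE _ (ne 2%N isT); have := lE _ (ne 1%N isT).
  by rewrite !sumE !psiE /= !adjE !add0r !addr0.
apply: (@double_point_pattern 6 psi (inord 0) t1 t2) => //.
- by rewrite t2E.
- split; first by move=> i; rewrite oner_eq0.
  + move=> v [i vi]; rewrite gt_eqF// (bigD1 i)//= ltr_pwDl//.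
    by apply: sumr_ge0.
  + move=> l l0 /linE[]; rewrite /t1 => l1 l2 l3 l4 l5.
    by apply: all6; lra.
- split.
  + by apply: all6; rewrite !t2E//; apply/eqP; lra.
  (* An outside vertex may see any nonempty part of one side of the domino; no nonempty partial sum
     of 1, -2/3, -2/3 or of -9, 6, 6 is zero. *)
  + move=> v [i vi].
    have : [|| adj v (inl r), adj v (inl r'), adj v (inl r''), adj v (inr c), adj v (inr c') |
               adj v (inr c'')].
      by move: i vi; apply: all6; rewrite !psiE => ->; rewrite ?orbT.
    rewrite sumE !t2E; case: v vi => a _ /=.
      by do 3!case: ifP => _ //=; move=> _; apply/eqP; lra.
    by do 3!case: ifP => _ //=; move=> _; apply/eqP; lra.
  + move=> l l0 /linE[]; rewrite !t2E l0 => l1 l2 l3 l4 l5.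
    by apply: all6; lra.
- by apply: all6; rewrite !sumE !psiE !t2E /t1/= ?adjE; lra.
- exists (inord 0), (inord 3); rewrite !psiE !t2E/= e1; split=> //.
  by apply/eqP; rewrite /t1; lra.
Qed.
End DoublePoints.

Section CycleDoublePoint.
Variables (R : realType) (m n : nat) (S : {set 'I_m * 'I_n}).
Notation V := ('I_m + 'I_n)%type.
Notation adj := (cell_adj S).

Definition chordless_cycle (L : nat) (v : nat -> V) : Prop :=
  (forall i j, (i < L)%N -> (j < L)%N -> v i = v j -> i = j) /\
  (forall i j, (i < L)%N -> (j < L)%N ->
     adj (v i) (v j) = (j == i.+1 %% L)%N || (i == j.+1 %% L)%N).

Variables (K : nat) (v : nat -> V).
Hypotheses (K2 : (1 < K)%N) (vC : chordless_cycle K.*2.+2 v).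
Let L := K.*2.+2.
Let psi (i : 'I_L) := v i.

Let adjE (i j : 'I_L) : adj (psi i) (psi j) = (j == ordS i) || (i == ordS j).
Proof. by rewrite /psi vC.2 ?ltn_ord. Qed.

Let sumE (i : 'I_L) (F : 'I_L -> R) :
  \sum_(j | adj (psi i) (psi j)) F j = F (ordS i) + F (ord_pred i).
Proof.
have ne : ord_pred i != ordS i.
  apply/eqP => /(congr1 (@ordS _)); rewrite ord_predK => /(congr1 val)/=.
  rewrite -(addn1 (i.+1 %% L)) modnDml addn1 => /eqP.
  rewrite -[X in X == _](modn_small (ltn_ord i)) -[X in X == _ %[mod _]]addn0 -addn2 eqn_modDl.
  by rewrite mod0n modn_small// /L !ltnS -addnn addn_gt0 (ltnW K2).
rewrite (bigD1 (ordS i))/=; last by rewrite adjE eqxx.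
rewrite (bigD1 (ord_pred i))/=; last by rewrite adjE ne andbT ord_predK eqxx orbT.
rewrite big1 ?addr0// => j /andP[/andP[+ j1] j2]; rewrite adjE (negbTE j1) => /eqP ij.
by case/eqP: j2; rewrite ij ordSK.
Qed.

(** With [la = l / t], the equation at a vertex says that the quantities
    [s j = p j * (la j + la j.+1)] of its two edges are opposite. Thus [s j] is [s 0] up to an
    alternating sign, and going once around from [la 0 = 0] returns to 0 only if [s 0] times the sum
    of the inverse edge products is 0. *)
Let rigid_cycle (t : 'I_L -> R) :
  (forall i, t i != 0) -> \sum_i (t i * t (ordS i))^-1 != 0 ->
  forall l : 'I_L -> R, l ord0 = 0 ->
    (forall i, i != ord0 ->
      l i * (\sum_(j | adj (psi i) (psi j)) t j) +
      t i * (\sum_(j | adj (psi i) (psi j)) l j) = 0) ->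
    forall i, l i = 0.
Proof.
move=> t0 St l l0 lE.
pose o j : 'I_L := inord (j %% L).
have oE (i : 'I_L) : o i = i by rewrite /o modn_small// inord_val.
have oS j : o j.+1 = ordS (o j).
  by apply: val_inj; rewrite /= !inordK ?ltn_mod// -[in RHS]addn1 modnDml addn1.
pose la j := l (o j) / t (o j).
pose p j := t (o j) * t (o j.+1).
pose s j := p j * (la j + la j.+1).
have p0 j : p j != 0 by rewrite mulf_neq0.
have lla j : l (o j) = la j * t (o j) by rewrite divfK.
have sS j : (j.+1 < L)%N -> s j.+1 = - s j.
  move=> jL; have := lE (o j.+1); rewrite !sumE -oS.
  have -> : ord_pred (o j.+1) = o j by rewrite oS ordSK.
  rewrite !lla.
  have -> : o j.+1 != ord0 by rewrite -val_eqE /= inordK ?ltn_mod// modn_small.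
  move=> /(_ isT) E; apply/eqP; rewrite -addr_eq0; apply/eqP; rewrite -[RHS]E /s /p; ring.
have sE j : (j < L)%N -> s j = (-1) ^+ j * s 0%N.
  elim: j => [_|j IH jL]; first by rewrite mul1r.
  by rewrite sS// IH ?(ltnW jL)// exprS mulN1r mulNr.
have la0 : la 0%N = 0 by rewrite /la (oE ord0) l0 mul0r.
have laE j : (j <= L)%N -> (-1) ^+ j * la j = - s 0%N * \sum_(x < j) (p x)^-1.
  elim: j => [_|j IH jL]; first by rewrite big_ord0 mulr0 mul1r la0.
  rewrite big_ord_recr/= mulrDr -IH ?(ltnW jL)// exprS.
  have -> : la j.+1 = (-1) ^+ j * s 0%N / p j - la j.
    by rewrite -sE// /s mulrAC mulfV// mul1r addrAC subrr add0r.
  have : (-1) ^+ j * (-1) ^+ j = 1 :> R by rewrite -expr2 sqrr_sign.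
  move: ((-1) ^+ j : R) => x xx.
  have -> : -1 * x * (x * s 0%N / p j - la j) = - (x * x) * (s 0%N / p j) + x * la j by ring.
  by rewrite xx; ring.
have oL : o L = o 0%N by rewrite /o modnn.
have s0 : s 0%N = 0.
  have := laE L (leqnn _); have -> : la L = 0 by rewrite /la oL -/(la 0%N).
  rewrite mulr0 => /esym/eqP; rewrite mulf_eq0 oppr_eq0 => /orP[/eqP//|/eqP S0].
  case/eqP: St; rewrite -[RHS]S0; apply: eq_bigr => i _; rewrite /p oS !oE.
  by [].
move=> i; have := laE i (ltnW (ltn_ord i)); rewrite s0 oppr0 mul0r => /eqP.
by rewrite mulf_eq0 signr_eq0/= /la oE mulf_eq0 invr_eq0 (negbTE (t0 i)) orbF => /eqP.
Qed.

(* Along the cycle, [T' i * T' i.+1] is obtained from [T i * T i.+1] by swapping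
   the values of the two edges at each odd vertex; these values differ by 1,
   which preserves the margins at the even vertices as well. *)
Let A : R := 2 ^+ K.
Let T (i : nat) : R :=
  if i == K.*2.+1 then (A - 1)^-1 else if odd i then - (2 ^+ i./2)^-1 else 2 ^+ i./2.
Let T' (i : nat) : R :=
  if i == K.*2.+1 then A / (A - 1) else if odd i then - 2 ^+ (i./2).+1 else (2 ^+ i./2)^-1.

Let pow_gt0 i : 0 < 2 ^+ i :> R. Proof. by rewrite exprn_gt0. Qed.

Let A4 : 4 <= A.
Proof.
rewrite /A -(subnKC K2) exprD; have -> : (2 : R) ^+ 2 = 4 by ring.
by rewrite ler_peMr// exprn_ege1// ler1n.
Qed.

Let A10 : 0 < A - 1. Proof. by have := A4; lra. Qed.

Let evenE a : (a <= K)%N -> (T a.*2 = 2 ^+ a) * (T' a.*2 = (2 ^+ a)^-1).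
Proof.
move=> aK; rewrite /T /T' !odd_double !doubleK.
by case: eqP => // /(congr1 odd); rewrite /= !odd_double.
Qed.

Let oddE a : (a < K)%N -> (T a.*2.+1 = - (2 ^+ a)^-1) * (T' a.*2.+1 = - 2 ^+ a.+1).
Proof.
move=> aK; rewrite /T /T' eqSS (inj_eq double_inj) ltn_eqF//= odd_double/= uphalf_double.
by [].
Qed.

(** The last weights [x] and [x'] solve [A * x = x' / A + 1] and [x = x' - 1], the relations
    required of the two closing edges by [edge_diff]. *)
Let lastE : (T K.*2.+1 = (A - 1)^-1) * (T' K.*2.+1 = A / (A - 1)).
Proof. by rewrite /T /T' eqxx. Qed.

Let indexP (P : nat -> Prop) : (forall a, (a <= K)%N -> P a.*2) ->
  (forall a, (a < K)%N -> P a.*2.+1) -> P K.*2.+1 -> forall i : 'I_L, P i.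
Proof.
move=> Pe Po Pl i; have := ltn_ord i; rewrite -(odd_double_half i); case: (odd i) => /=.
  rewrite add1n ltnS ltnS leq_eqVlt => /orP[/eqP/double_inj ->//|].
  by rewrite ltn_double; exact: Po.
rewrite add0n ltnS => iK; apply: Pe; rewrite -leq_double; move: iK.
by rewrite leq_eqVlt => /orP[/eqP/(congr1 odd)|//]; rewrite /= !odd_double.
Qed.

Let val_ordS (i : 'I_L) : (ordS i : nat) = if (i == K.*2.+1 :> nat) then 0%N else i.+1.
Proof.
case: eqP => [iK|/eqP iK] /=; first by rewrite iK modnn.
by rewrite modn_small// ltnS ltn_neqAle iK -ltnS ltn_ord.
Qed.

Let edgeE a : (a < K)%N ->
  (T a.*2 * T a.*2.+1 = -1) * (T' a.*2 * T' a.*2.+1 = -2) *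
  (T a.*2.+1 * T a.*2.+2 = -2) * (T' a.*2.+1 * T' a.*2.+2 = -1).
Proof.
move=> aK; have p0 : 2 ^+ a != 0 :> R by rewrite gt_eqF.
rewrite !(evenE (ltnW aK)) !(oddE aK) -doubleS !(evenE aK) exprS.
by do !split; field; rewrite p0.
Qed.

Let edge_lastE : (T K.*2 * T K.*2.+1 = A / (A - 1)) * (T' K.*2 * T' K.*2.+1 = (A - 1)^-1) *
  (T K.*2.+1 * T 0 = (A - 1)^-1) * (T' K.*2.+1 * T' 0 = A / (A - 1)).
Proof.
have A0 : A != 0 by rewrite gt_eqF ?pow_gt0.
have A1 : A - 1 != 0 by rewrite gt_eqF.
rewrite !(@evenE K)// !lastE -[0%N]double0 !(@evenE 0)// expr0 invr1 -/A.
by do !split; field; rewrite ?A0 A1.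
Qed.

Let edge_diff (i : 'I_L) : T i * T (ordS i) = T' i * T' (ordS i) + (-1) ^+ i.
Proof.
rewrite val_ordS; move: i; 
apply: (@indexP (fun i => T i * T (if i == K.*2.+1 then 0 else i.+1)%N =
  T' i * T' (if i == K.*2.+1 then 0 else i.+1)%N + (-1) ^+ i)) => [a|a aK|].
- rewrite leq_eqVlt => /orP[/eqP ->|aK].
    rewrite ifN ?edge_lastE; last by apply/eqP => /(congr1 odd); rewrite /= !odd_double.
    rewrite -signr_odd odd_double expr0; field; rewrite gt_eqF//.
  rewrite ifN ?edgeE//; last by apply/eqP => /(congr1 odd); rewrite /= !odd_double.
  by rewrite -signr_odd odd_double expr0; ring.
- by rewrite ifN ?edgeE ?eqSS ?(inj_eq double_inj) ?ltn_eqF// -signr_odd/= odd_double expr1; ring.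
- rewrite eqxx !edge_lastE -signr_odd/= odd_double expr1; field; rewrite gt_eqF//.
Qed.

(** For both points the inverse edge products sum to -3/2 over each of the [K] pairs and to
    [(A - 1) / A + (A - 1) = A - A^-1] over the closing edges. The total would be 0 for a 4-cycle,
    [K = 1]; for [K >= 2] the bound [2 * K <= A] makes it exceed [K / 2 - 1]. *)
Let edge_sum_neq0 : A - A^-1 - 3 / 2 * K%:R != 0.
Proof.
have : 2 * K%:R <= A.
  rewrite /A -natrX -natrM ler_nat; move: K2; case: (K) => // k _.
  by rewrite expnS leq_pmul2l// ltn_expl.
have : (2 : R) <= K%:R by rewrite ler_nat.
have : A^-1 < 1 by rewrite invf_lt1//; have := A4; lra.
by move=> *; apply/eqP; lra.
Qed.

Let cycle_inv_sum (U : nat -> R) :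
  (forall a, (a < K)%N -> (U a.*2 * U a.*2.+1)^-1 + (U a.*2.+1 * U a.*2.+2)^-1 = - (3 / 2)) ->
  (U K.*2 * U K.*2.+1)^-1 + (U K.*2.+1 * U 0)^-1 = A - A^-1 ->
  \sum_(i < L) (U i * U (ordS i))^-1 != 0.
Proof.
move=> U1 U2; under eq_bigr do rewrite val_ordS.
rewrite /L !big_ord_recr/= eqxx ifN; last first.
  by apply/eqP => /(congr1 odd); rewrite /= !odd_double.
have -> : \sum_(i < K.*2) (U i * U (if i == K.*2.+1 :> nat then 0%N else i.+1))^-1 =
    \sum_(i < K.*2) (U i * U i.+1)^-1.
  by apply: eq_bigr => i _; rewrite ltn_eqF// ltnS ltnW.
have -> : \sum_(i < K.*2) (U i * U i.+1)^-1 = - (3 / 2) * K%:R.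
  have : (K <= K)%N by []. 
  elim: {-2}K => [|a IH] aK; first by rewrite big_ord0 mulr0.
  rewrite doubleS !big_ord_recr/= IH ?(ltnW aK)// -addrA U1//.
  by rewrite -[in RHS]addn1 natrD; ring.
rewrite -addrA U2; have := edge_sum_neq0; apply: contraNneq => <-.
by rewrite mulNr addrC.
Qed.

Lemma cycle_double_point : exists H v0 z z', @double_point R m n S H v0 z z'.
Proof.
have A0 : A != 0 by rewrite gt_eqF ?pow_gt0.
have A1 : A - 1 != 0 by rewrite gt_eqF.
have T0 (i : 'I_L) : T i != 0.
  move: i; apply: (@indexP (fun i => T i != 0)) => [a aK|a aK|].
  - by rewrite evenE// gt_eqF.
  - by rewrite oddE// oppr_eq0 invr_eq0 gt_eqF.
  - by rewrite lastE invr_eq0 gt_eqF.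
have T'0 (i : 'I_L) : T' i != 0.
  move: i; apply: (@indexP (fun i => T' i != 0)) => [a aK|a aK|].
  - by rewrite evenE// invr_eq0 gt_eqF.
  - by rewrite oddE// oppr_eq0 gt_eqF.
  - by rewrite lastE mulf_neq0 ?invr_eq0 ?A0 ?A1.
have parity (x : V) (i j : 'I_L) : adj x (psi i) -> adj x (psi j) -> odd i = odd j.
  pose col (y : V) := if y is inl _ then true else false.
  have cadj y y' : adj y y' -> col y' = ~~ col y by case: y; case: y'.
  have cE k : (k < L)%N -> col (v k) = col (v 0) (+) odd k.
    elim: k => [_|k IH kL]; first by rewrite addbF.
    rewrite (cadj (v k)) ?IH ?(ltnW kL)//=; first by rewrite addbN.
    by rewrite vC.2 ?(ltnW kL)// modn_small// eqxx.
  move=> /cadj xi /cadj xj; have : col (v i) = col (v j) by rewrite xi xj.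
  by rewrite (cE i (ltn_ord i)) (cE j (ltn_ord j)) => /addbI.
(* An outside vertex sees indices of one parity only. Even coordinates are positive; among the odd
   ones any negative coordinate outweighs the single positive one, at [ord_max]. *)
have signs (U : 'I_L -> R) (x : V) : (forall i : 'I_L, ~~ odd i -> 0 < U i) ->
    (forall i : 'I_L, odd i -> i != ord_max -> U i < 0 /\ U i + U ord_max < 0) ->
    0 < U ord_max ->
    (exists i, adj x (psi i)) -> \sum_(i | adj x (psi i)) U i != 0.
  move=> Ue Uo Um [i xi].
  have [io|ie] := boolP (odd i); last first.
    rewrite gt_eqF// (bigD1 i)//= ltr_pwDl ?Ue//; apply: sumr_ge0 => j /andP[xj _].
    by rewrite ltW// Ue// (parity _ _ _ xj xi).
  have [/existsP[j /andP[xj jm]]|no] := boolP [exists j, adj x (psi j) && (j != ord_max)].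
    have jo : odd j by rewrite (parity _ _ _ xj xi).
    have le0 (F : pred 'I_L) : \sum_(y | [&& adj x (psi y), y != j, y != ord_max & F y]) U y <= 0.
      apply: sumr_le0 => y /and4P[xy yj ym _].
      by rewrite ltW// (Uo y _ ym).1// (parity _ _ _ xy xi).
    rewrite lt_eqF// (bigD1 j)//=.
    have [xm|xm] := boolP (adj x (psi ord_max)).
      rewrite (bigD1 ord_max)/=; last by rewrite xm eq_sym.
      rewrite addrA ltr_wnDr//; last exact: (Uo j jo jm).2.
      rewrite (eq_bigl (fun y => [&& adj x (psi y), y != j, y != ord_max & true])) ?le0// => y.
      by rewrite andbT andbA.
    rewrite ltr_wnDr ?(Uo j jo jm).1//.
    rewrite (eq_bigl (fun y => [&& adj x (psi y), y != j, y != ord_max & true])) ?le0// => y.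
    rewrite andbT; case: (eqVneq y ord_max) => [->|]; rewrite ?andbT//.
    by rewrite (negbTE xm).
  rewrite gt_eqF// (bigD1 i)//= big1 ?addr0.
    suff -> : i = ord_max by [].
    by apply/eqP; apply: contraNT no => im; apply/existsP; exists i; rewrite xi.
  move=> j /andP[xj ji]; move/existsPn: no => no.
  by have := no j; have := no i; rewrite xi xj/= !negbK => /eqP im /eqP jm; rewrite jm im eqxx in ji.
have maxE : (ord_max : 'I_L) = K.*2.+1 :> nat by [].
have even_pos (U : nat -> R) : (forall a, (a <= K)%N -> 0 < U a.*2) ->
    forall i : 'I_L, ~~ odd i -> 0 < U i.
  move=> U0; apply: (@indexP (fun i => ~~ odd i -> 0 < U i)) => [a /U0//|a _|].
    by rewrite /= odd_double.
  by rewrite /= odd_double.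
have odd_neg (U : nat -> R) : (forall a, (a < K)%N -> U a.*2.+1 < 0 /\ U a.*2.+1 + U K.*2.+1 < 0) ->
    forall i : 'I_L, odd i -> i != ord_max -> U i < 0 /\ U i + U K.*2.+1 < 0.
  move=> U0 i io im; have {im} : (i != K.*2.+1 :> nat) by [].
  move: i io; apply: (@indexP (fun i => odd i -> i != K.*2.+1 -> U i < 0 /\ U i + U K.*2.+1 < 0)).
  - by move=> a _; rewrite odd_double.
  - by move=> a /U0.
  - by rewrite eqxx.
have Asplit : A = 2 * 2 ^+ K.-1 by rewrite /A -exprS prednK// ltnW.
have Te : forall i : 'I_L, ~~ odd i -> 0 < T i.
  by apply: even_pos => a aK; rewrite evenE.
have T'e : forall i : 'I_L, ~~ odd i -> 0 < T' i.
  by apply: even_pos => a aK; rewrite evenE// invr_gt0.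
have To : forall i : 'I_L, odd i -> i != ord_max -> T i < 0 /\ T i + T K.*2.+1 < 0.
  apply: odd_neg => a aK; rewrite oddE// lastE oppr_lt0 invr_gt0; split=> //.
  rewrite addrC subr_lt0 ltf_pV2 ?posrE//.
  have : 2 ^+ a <= 2 ^+ K.-1 :> R by rewrite ler_weXn2l ?ler1n// -ltnS prednK// ltnW.
  by have := A4; lra.
have T'o : forall i : 'I_L, odd i -> i != ord_max -> T' i < 0 /\ T' i + T' K.*2.+1 < 0.
  apply: odd_neg => a aK; rewrite oddE// lastE oppr_lt0; split=> //.
  rewrite addrC subr_lt0 ltr_pdivrMr//.
  have : 1 <= 2 ^+ a :> R by rewrite exprn_ege1// ler1n.
  have : 0 <= (2 ^+ a - 1) * (A - 1) by rewrite mulr_ge0 ?subr_ge0 ?exprn_ege1 ?ler1n// ltW.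
  by have := A4; rewrite exprS; lra.
have succ_adj (i : 'I_L) : adj (psi i) (psi (ordS i)) by rewrite adjE eqxx.
apply: (@double_point_pattern R m n S L psi ord0 (fun i => T i) (fun i => T' i)).
- by move=> i j /(vC.1 _ _ (ltn_ord i) (ltn_ord j))/val_inj.
- by have := @evenE 0 isT => /= -[-> ->]; rewrite invr1.
- move=> i; split; last by exists (ordS i).
  have : forall k, (k < L)%N -> connect adj (v 0) (v k).
    elim=> [_|k IH kL]; first exact: connect0.
    apply: connect_trans (IH (ltnW kL)) _; apply: connect1.
    by rewrite vC.2 ?(ltnW kL)// modn_small// eqxx.
  exact.
- split=> // [x xi|].
    by apply: signs => //; rewrite maxE lastE invr_gt0.
  apply: rigid_cycle => //; apply: cycle_inv_sum => [a aK|].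
    by rewrite !edgeE//; field.
  by rewrite !edge_lastE; field; rewrite A0 A1.
- split=> // [x xi|].
    by apply: signs => //; rewrite maxE lastE divr_gt0 ?pow_gt0.
  apply: rigid_cycle => //; apply: cycle_inv_sum => [a aK|].
    by rewrite !edgeE//; field.
  by rewrite !edge_lastE; field; rewrite A0 A1.
- move=> i; rewrite !sumE; have [j ij] : exists j : 'I_L, i = ordS j.
    by exists (ord_pred i); rewrite ord_predK.
  have := edge_diff i; have := edge_diff j; rewrite -ij [X in ord_pred X]ij ordSK.
  have -> : (-1) ^+ i = - (-1) ^+ j :> R.
    rewrite ij val_ordS; case: eqP => [->|_]; last by rewrite exprS mulN1r.
    by rewrite -[in RHS]signr_odd /= odd_double expr1 opprK.
  move=> h1 h2; rewrite !mulrDr h2 [T i * T j]mulrC h1; ring.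
- exists ord0, (ordS ord0); split=> //.
  by rewrite edge_diff expr0 -subr_eq0 addrAC subrr add0r oner_eq0.
Qed.
End CycleDoublePoint.

(** * Zariski density of real boxes *)

Local Open Scope complex_scope.

Section PolynomialVanishing.
Variable R : realType.
Implicit Types (N : nat).

Lemma poly_eq0_seq (p : {poly R[i]}) (t : nat -> R) :
  injective t -> (forall k, p.[(t k)%:C] = 0) -> p = 0.
Proof.
move=> tI p0; apply/eqP; apply: contraT => pn0.
pose s := [seq (t k)%:C | k <- iota 0 (size p)].
have us : uniq s.
  by rewrite map_inj_uniq ?iota_uniq// => k l /complexI/tI.
have rs : all (root p) s by apply/allP => _ /mapP[k _ ->]; apply/rootP.
by have := max_poly_roots pn0 rs us; rewrite size_map size_iota ltnn.
Qed.

Lemma meval_mderiv N (i : 'I_N) (p : mpoly N R[i]) (x : 'I_N -> R[i]) :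
  meval x (mderiv i p) =
  \sum_(m <- msupp p) mcoeff m p * ((m i)%:R * \prod_k x k ^+ (m k - (k == i))).
Proof.
rewrite /mderiv raddf_sum; apply: eq_bigr => m _.
rewrite [LHS]mevalZ mevalX mulrA [_ * mcoeff _ _]mulrC; congr (_ * _).
by apply: eq_bigr => k _; rewrite mnmBE mnm1E eq_sym.
Qed.

(* By induction on the degree: the partial derivatives vanish on the half-size
   box. *)
Lemma mpoly_vanishing_box N (p : mpoly N R[i]) (x0 : 'I_N -> R) (d : R) :
  0 < d -> (forall x : 'I_N -> R, (forall k, `|x k - x0 k| <= d) ->
              meval (fun k => (x k)%:C) p = 0) -> p = 0.
Proof.
suff H B : forall (p : mpoly N R[i]) d, (forall m, (B <= mdeg m)%N -> mcoeff m p = 0) ->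
    0 < d -> (forall x : 'I_N -> R, (forall k, `|x k - x0 k| <= d) ->
              meval (fun k => (x k)%:C) p = 0) -> p = 0.
  move=> d0; apply: (H (msize p)) => // m; apply: contraTeq.
  by rewrite -ltnNge -mcoeff_msupp; exact: msize_mdeg_lt.
elim: B => [|B IH] {}p {}d pB d0 p0; first by apply/mpolyP => m; rewrite pB// mcoeff0.
have dp0 i : mderiv i p = 0.
  apply: (IH _ (d / 2)); rewrite ?divr_gt0//.
    by move=> m mB; rewrite mcoeff_deriv pB ?mul0rn// mdegD mdeg1 addn1 ltnS.
  move=> x xd; rewrite meval_mderiv.
  (* [q] is the restriction of [p] to the line through [x] in direction [i]. It vanishes at the
     infinitely many parameters [t k], small enough to stay in the box, so it is 0; its derivative
     at 0 is the partial derivative of [p] at [x]. *)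
  pose a k : {poly R[i]} := (x k)%:C%:P + (k == i)%:R *: 'X.
  pose q := \sum_(m <- msupp p) mcoeff m p *: \prod_k a k ^+ m k.
  have q0 : q = 0.
    pose t k : R := d / 2 / k.+1%:R.
    apply: (@poly_eq0_seq q t) => [k l|k].
      move=> /(mulfI _) kl; have /invr_inj/eqP := kl (lt0r_neq0 (divr_gt0 d0 (ltr0n _ 2))).
      by rewrite eqr_nat eqSS => /eqP.
    have -> : q.[(t k)%:C] = meval (fun l => (x l + (l == i)%:R * t k)%:C) p.
      rewrite mevalE horner_sum; apply: eq_bigr => m _.
      rewrite hornerZ horner_prod; congr (_ * _); apply: eq_bigr => l _.
      rewrite horner_exp hornerD hornerC hornerZ hornerX; congr (_ ^+ _).
      by case: (l == i); rewrite ?scale1r ?scale0r ?mul1r ?mul0r ?addr0 ?rmorphD /= ?hornerX ?horner0 ?addr0.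
    apply: p0 => l; rewrite addrAC (le_trans (ler_normD _ _))//.
    have -> : d = d / 2 + d / 2 by rewrite -splitr.
    have t0 : 0 <= t k by rewrite !divr_ge0// ltW.
    apply: lerD => //; apply: (@le_trans _ _ (t k)).
      by case: (l == i); rewrite ?mul1r ?mul0r ?normr0 ?ger0_norm.
    by rewrite /t ler_pdivrMr ?ltr0n// ler_peMr ?divr_ge0 ?(ltW d0)// ler1n.
  transitivity q^`().[0]; last by rewrite q0 deriv0 horner0.
  rewrite /q (big_morph _ (@derivD _) (@deriv0 _)) horner_sum; apply: eq_bigr => m _.
  rewrite derivZ hornerZ; congr (_ * _).
  rewrite [in RHS](bigD1 i)//= [in LHS](bigD1 i)//= eqxx.
  pose c := \prod_(k | k != i) (x k)%:C ^+ m k.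
  have -> : \prod_(k | k != i) a k ^+ m k = c%:P.
    rewrite rmorph_prod; apply: eq_bigr => k ki.
    by rewrite /a (negbTE ki) scale0r addr0 rmorphXn.
  have -> : \prod_(k | k != i) (x k)%:C ^+ (m k - (k == i)) = c.
    by apply: eq_bigr => k ki; rewrite (negbTE ki) subn0.
  rewrite mulrC -[_ * c%:P]mulrC derivM derivC mul0r add0r deriv_exp /a eqxx scale1r.
  rewrite derivD derivC derivX add0r mul1r hornerM hornerC hornerMn horner_exp.
  rewrite hornerD hornerC hornerX addr0 -mulr_natl subn1; ring.
have pE m : m != mnm0 -> mcoeff m p = 0.
  move=> m0.
  have [i mi] : exists i, m i != 0%N.
    apply/existsP; apply: contraNT m0 => /existsPn m0; apply/eqP/mnmP => i.
    by rewrite mnm0E; apply/eqP; rewrite -[_ == _]negbK.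
  have := congr1 (mcoeff (mnm_sub m (mnm1 i))) (dp0 i).
  rewrite mcoeff_deriv submK ?mcoeff0; last first.
    by apply/mnm_lepP => k; rewrite mnm1E; case: eqP => [<-|//]; rewrite lt0n.
  by move/eqP; rewrite mulrn_eq0/= => /eqP.
have pC : p = mpolyC N (mcoeff mnm0 p).
  apply/mpolyP => m; rewrite mcoeffC; case: eqP => [->|/eqP m0]; rewrite ?mulr1//.
  by rewrite pE //; symmetry; exact: mulr0.
have c0 : mcoeff mnm0 p = 0.
  have := p0 x0; rewrite {1}pC mevalC; apply => k.
  by rewrite subrr normr0 ltW.
by rewrite pC c0 mpolyC0.
Qed.
End PolynomialVanishing.

(** * Two critical points *)

(** Binomials of the vanishing ideal only see integer kernel vectors, while the difference of two
    tables is real. The kernel of a rational matrix has a rational basis, and clearing denominators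
    makes it integral. *)
Lemma rational_kernel_orthogonal (R : realType) (p N : nat) (M : 'M[rat]_(p, N))
    (xi : 'I_N -> R[i]) (w : 'cV[R]_N) :
  (forall e : 'I_N -> int, M *m (\col_k (e k)%:~R) = 0 -> \sum_k (e k)%:~R * xi k = 0) ->
  map_mx ratr M *m w = 0 -> \sum_k (w k 0)%:C * xi k = 0.
Proof.
move=> Hint Mw.
have /submxP[c wE] : (w^T <= map_mx ratr (kermx M^T))%MS.
  by rewrite map_kermx; apply/sub_kermxP; rewrite -map_trmx -trmx_mul Mw trmx0.
have -> : \sum_k (w k 0)%:C * xi k =
    \sum_i (c 0 i)%:C * \sum_k (ratr (kermx M^T i k))%:C * xi k.
  under [RHS]eq_bigr do rewrite mulr_sumr.
  rewrite exchange_big/=; apply: eq_bigr => k _.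
  have -> : w k 0 = w^T 0 k by rewrite mxE.
  rewrite wE mxE rmorph_sum mulr_suml/=; apply: eq_bigr => i _.
  by rewrite rmorphM/= mulrA mxE.
apply: big1 => i _; set r := kermx M^T i; apply/eqP; rewrite mulf_eq0; apply/orP; right.
pose d := \prod_k denq (r k).
pose e k := numq (r k) * \prod_(l | l != k) denq (r l).
have d0 : d != 0 by apply/prodf_neq0 => k _; exact: denq_neq0.
have eE k : (e k)%:~R = d%:~R * r k :> rat.
  have -> : d = denq (r k) * \prod_(l | l != k) denq (r l) by rewrite /d (bigD1 k).
  by rewrite /e !intrM numqE; ring.
have Me : M *m (\col_k (e k)%:~R) = 0.
  have -> : (\col_k (e k)%:~R) = d%:~R *: (row i (kermx M^T))^T :> 'cV[rat]_N.
    apply/matrixP => k j; rewrite mxE [RHS]mxE [(row _ _)^T _ _]mxE [row _ _ _ _]mxE.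
    exact: eE.
  rewrite -scalemxAr -[M in M *m _]trmxK -trmx_mul -row_mul mulmx_ker row0 trmx0.
  by rewrite scaler0.
have dC : d%:~R != 0 :> R[i] by rewrite intr_eq0.
rewrite -(inj_eq (mulfI dC)) mulr0 mulr_sumr; apply/eqP.
transitivity (\sum_k (e k)%:~R * xi k); last exact: Hint.
apply: eq_bigr => k _; rewrite mulrA; congr (_ * _).
have eR : (e k)%:~R = d%:~R * ratr (r k) :> R.
  have : ratr (e k)%:~R = ratr (d%:~R * r k) :> R by rewrite eE.
  by rewrite ratr_int [RHS]rmorphM /= ratr_int.
by rewrite -(rmorph_int (real_complex R) d) -rmorphM -eR rmorph_int.
Qed.

Section CriticalPoints.
Variables (R : realType) (m n : nat) (S : {set 'I_m * 'I_n}).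
Notation V := ('I_m + 'I_n)%type.
Implicit Types (u : 'I_m * 'I_n -> R) (z : V -> R).

Definition cell_vector u : 'cV[R]_#|S| := \col_k u (enum_val k).

Lemma sum_cells (F : 'I_m * 'I_n -> R) : \sum_(k < #|S|) F (enum_val k) = \sum_(s in S) F s.
Proof. by rewrite [RHS]big_enum_val. Qed.

Lemma margin_row u i : margin S u (inl i) = \sum_(s in S | s.1 == i) u s.
Proof.
rewrite /margin big_sumType/= big_pred0 ?add0r//.
rewrite (reindex_onto (fun j => (i, j)) snd) => [|[i' j]/andP[_ /eqP/= ->]//].
by apply: eq_bigl => j; rewrite /= !eqxx !andbT.
Qed.

Lemma margin_col u j : margin S u (inr j) = \sum_(s in S | s.2 == j) u s.
Proof.
rewrite /margin big_sumType/= [X in _ + X]big_pred0 ?addr0//.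
rewrite [RHS](reindex_onto (fun i => (i, j)) fst) => [|[i j']/andP[_ /eqP/= ->]//].
by apply: eq_bigl => i; rewrite /= !eqxx !andbT.
Qed.

Lemma A_S_mul u : A_S R S *m cell_vector u =
  col_mx (\col_i margin S u (inl i)) (\col_j margin S u (inr j)).
Proof.
rewrite /A_S mul_col_mx; congr col_mx; apply/matrixP => i j; rewrite !mxE.
  rewrite margin_row big_mkcondr/= -(sum_cells (fun s => if s.1 == i then u s else 0)).
  by apply: eq_bigr => k _; rewrite !mxE; case: eqP; rewrite ?mul1r ?mul0r.
rewrite margin_col big_mkcondr/= -(sum_cells (fun s => if s.2 == i then u s else 0)).
by apply: eq_bigr => k _; rewrite !mxE; case: eqP; rewrite ?mul1r ?mul0r.
Qed.

Lemma additive_sub_A_S (al : 'I_m -> R) (be : 'I_n -> R) (x : 'rV[R]_#|S|) :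
  (forall k, x 0 k = al (enum_val k).1 + be (enum_val k).2) -> (x <= A_S R S)%MS.
Proof.
move=> xE; apply/submxP; exists (row_mx (\row_i al i) (\row_j be j)).
rewrite /A_S mul_row_col; apply/matrixP => i k; rewrite (ord1 i) xE !mxE.
congr (_ + _).
  rewrite (bigD1 (enum_val k).1)//= big1 ?addr0 ?mxE ?eqxx ?mulr1// => i' ne.
  by rewrite !mxE eq_sym (negbTE ne) mulr0.
rewrite (bigD1 (enum_val k).2)//= big1 ?addr0 ?mxE ?eqxx ?mulr1// => i' ne.
by rewrite !mxE eq_sym (negbTE ne) mulr0.
Qed.

Definition normalized z : 'cV[R]_#|S| :=
  (\sum_(s in S) rank_one z s)^-1 *: cell_vector (rank_one z).

Lemma normalized_sum z : \sum_(s in S) rank_one z s != 0 -> \sum_k normalized z k 0 = 1.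
Proof.
move=> s0; under eq_bigr do rewrite !mxE.
by rewrite -mulr_sumr sum_cells mulVf.
Qed.

Lemma normalized_model z : S != finset.set0 -> (forall v, 0 < z v) -> @model R m n S (normalized z).
Proof.
move=> /finset.set0Pn[s0 s0S] z0.
have r0 s : 0 < rank_one z s by rewrite mulr_gt0.
have sig0 : 0 < \sum_(s in S) rank_one z s.
  by rewrite (bigD1 s0)//= ltr_pwDl// sumr_ge0// => s _; rewrite ltW.
split=> [k||].
- by rewrite !mxE mulr_gt0 ?invr_gt0.
- by rewrite normalized_sum// gt_eqF.
- apply: (@additive_sub_A_S (fun i => ln (z (inl i)) - ln (\sum_(s in S) rank_one z s))
    (fun j => ln (z (inr j)))) => k.
  rewrite !mxE lnM ?posrE ?invr_gt0// lnM ?posrE// lnV ?posrE//; ring.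
Qed.

(** The segment from the all-ones point to [z] starts among the positive points, where [normalized]
    lands in the model. Along it [f] becomes, after clearing denominators, a polynomial in [t] with
    infinitely many zeros, so it also vanishes at [t = 1]. *)
Lemma normalized_closure z : \sum_(s in S) rank_one z s != 0 ->
  @zariski_closure R m n S (map_mx (real_complex R) (normalized z)).
Proof.
move=> sz0 f fI.
have S0 : S != finset.set0 by apply: contraNneq sz0 => ->; rewrite finset.big_set0.
pose zr t v : R := 1 + (z v - 1) * t.
pose sig t := \sum_(s in S) rank_one (zr t) s.
pose zt v : {poly R[i]} := 1 + (z v - 1)%:C%:P * 'X.
pose a s := zt (inl s.1) * zt (inr s.2).
pose D := \sum_(s in S) a s.
pose M := msize f.
(* Every coordinate of [normalized] has denominator [D] and all degrees are at most [M], so this is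
   [D ^+ M] times [f] along the segment. *)
pose h := \sum_(mm <- msupp f) mcoeff mm f *:
   (\prod_k a (enum_val k) ^+ mm k * D ^+ (M - mdeg mm)).
have ztE v t : (zt v).[t%:C] = (zr t v)%:C.
  by rewrite /zt hornerD hornerM !hornerC hornerX /zr [RHS]rmorphD /= [in RHS]rmorphM.
have aE s t : (a s).[t%:C] = (rank_one (zr t) s)%:C by rewrite hornerM !ztE -rmorphM.
have DE t : D.[t%:C] = (sig t)%:C.
  by rewrite horner_sum rmorph_sum; apply: eq_bigr => s _; rewrite aE.
have hE t : sig t != 0 -> h.[t%:C] =
    (sig t)%:C ^+ M * eval_at f (map_mx (real_complex R) (normalized (zr t))).
  move=> st; rewrite /eval_at mevalE horner_sum mulr_sumr [LHS]big_seq [RHS]big_seq.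
  apply: eq_bigr => mm mmf; rewrite hornerZ hornerM horner_prod horner_exp DE [RHS]mulrCA; congr (_ * _).
  have stC : (sig t)%:C != 0 by rewrite fmorph_eq0.
  have mM : (mdeg mm <= M)%N by rewrite ltnW// msize_mdeg_lt.
  under eq_bigr do rewrite horner_exp aE.
  have -> : \prod_i map_mx (real_complex R) (normalized (zr t)) i 0 ^+ mm i =
      (sig t)%:C ^- (mdeg mm) * \prod_i (rank_one (zr t) (enum_val i))%:C ^+ mm i.
    under eq_bigr do rewrite !mxE rmorphM exprMn fmorphV.
    by rewrite big_split/= prodrXr mdegE exprVn.
  rewrite -[in RHS](subnK mM) exprD mulrC mulrA; congr (_ * _).
  by rewrite mulfK// expf_neq0.
have h0 : h = 0.
  pose W := \sum_v `|z v - 1|.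
  have W0 : 0 <= W by apply: sumr_ge0.
  pose t k : R := (k.+1%:R + W)^-1.
  have t0 k : 0 < t k by rewrite invr_gt0 ltr_pwDl.
  apply: (@poly_eq0_seq _ _ t) => [k l /invr_inj/addIr/eqP|k].
    by rewrite eqr_nat eqSS => /eqP.
  have zpos v : 0 < zr (t k) v.
    have : `|(z v - 1) * t k| < 1.
      rewrite normrM (gtr0_norm (t0 k)) -ltr_pdivlMr// div1r invrK ltr_pwDl//.
      by rewrite /W (bigD1 v)//= lerDl sumr_ge0.
    by rewrite /zr ltr_norml => /andP[h1 _]; lra.
  have mod := normalized_model S0 zpos.
  rewrite hE ?fI ?mulr0//; apply/eqP => s0.
  have [_ + _] := mod; rewrite /normalized -/(sig (t k)) s0 invr0 scale0r.
  by rewrite big1 => [/eqP|k' _]; rewrite ?mxE// eq_sym oner_eq0.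
have zr1 : zr 1 = z by apply/funext => v; rewrite /zr mulr1 addrC subrK.
have s1 : sig 1 != 0 by rewrite /sig zr1.
have := hE _ s1; rewrite h0 horner0 zr1 => /esym/eqP; rewrite mulf_eq0 expf_eq0 fmorph_eq0.
by rewrite (negbTE s1) andbF => /eqP.
Qed.

(** On the model [ln q] lies in the row span, hence is orthogonal to [a - b], and the two monomials
    agree. *)
Lemma binomial_vanishing (a b : 'I_#|S| -> nat) :
  (A_S R S *m (\col_k ((a k)%:R - (b k)%:R)) = 0) ->
  vanishing_ideal (mpolyX R[i] (Multinom [tuple a k | k < #|S|]) -
                   mpolyX R[i] (Multinom [tuple b k | k < #|S|])).
Proof.
move=> Aab q [q0 _ /submxP[y yE]].
have prodE (c : 'I_#|S| -> nat) :
    meval (fun k => map_mx (real_complex R) q k 0) (mpolyX R[i] (Multinom [tuple c k | k < #|S|])) =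
    (expR (\sum_k (c k)%:R * ln (q k 0)))%:C.
  rewrite mevalX expR_sum rmorph_prod; apply: eq_bigr => k _.
  by rewrite mnmE mxE expRM_natl lnK ?posrE// [RHS]rmorphXn.
rewrite /eval_at mevalB !prodE; apply/eqP; rewrite subr_eq0; apply/eqP.
congr ((expR _)%:C); apply/eqP; rewrite -subr_eq0 -sumrB; apply/eqP.
have : (y *m A_S R S) *m (\col_k ((a k)%:R - (b k)%:R)) = 0 by rewrite -mulmxA Aab mulmx0.
rewrite -yE => /matrixP/(_ 0 0); rewrite !mxE => E; rewrite -[RHS]E.
by apply: eq_bigr => k _; rewrite !mxE; ring.
Qed.

Lemma sum_one_vanishing :
  vanishing_ideal (\sum_(k < #|S|) mpolyX R[i] (mnm1 k) - 1 : mpoly #|S| R[i]).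
Proof.
move=> q [_ q1 _]; rewrite /eval_at mevalB meval1 raddf_sum/=.
under eq_bigr do rewrite mevalXU mxE.
by rewrite -rmorph_sum/= q1 subrr.
Qed.

(** Tangency to the binomials makes [xi = v / p] orthogonal to the integer kernel of [A_S], hence to
    [u - rank_one z], whose margins vanish. What remains of the gradient condition is [sig] times
    the sum of [v], which is 0 by tangency to the sum-one hyperplane. *)
Lemma normalized_critical u z :
  (forall v, z v != 0) -> (forall v, margin S (rank_one z) v = margin S u v) ->
  \sum_(s in S) rank_one z s != 0 ->
  critical_points (map_mx (real_complex R) (cell_vector u))
    (map_mx (real_complex R) (normalized z)).
Proof.
move=> z0 zu sz0; set p := normalized z; set pc := map_mx _ p.
set sig := \sum_(s in S) rank_one z s in sz0.
have p0 k : p k 0 != 0 by rewrite !mxE !mulf_neq0// invr_eq0.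
have pc0 k : pc k 0 != 0 by rewrite mxE fmorph_eq0.
have cl := normalized_closure sz0.
split=> //.
  under eq_bigr do rewrite mxE.
  by rewrite -rmorph_sum/= normalized_sum.
move=> v tv; pose xi k := v k 0 / pc k 0.
have vxi k : v k 0 = pc k 0 * xi k by rewrite mulrC divfK.
have v0 : \sum_k v k 0 = 0.
  have := tv _ sum_one_vanishing; under eq_bigr => k _.
    rewrite mderivB mderivC subr0 raddf_sum/=.
    rewrite (bigD1 k)//= big1 ?addr0; last first.
      by move=> l lk; rewrite mderivX mnm1E (negbTE lk) scale0r.
    rewrite mderivX mnm1E eqxx scale1r /eval_at.
    have -> : mnm_sub (mnm1 k) (mnm1 k) = mnm0 :> multinom #|S|.
      by apply/mnmP => l; rewrite mnmBE mnm0E subnn.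
    rewrite mpolyX0 meval1 mul1r.
    over.
  by [].
have xi0 : \sum_k (cell_vector (fun s => u s - rank_one z s) k 0)%:C * xi k = 0.
  pose M : 'M[rat]_(m + n, #|S|) :=
    col_mx (\matrix_(i < m, k < #|S|) ((enum_val k).1 == i)%:R)
           (\matrix_(j < n, k < #|S|) ((enum_val k).2 == j)%:R).
  have MA : map_mx ratr M = A_S R S.
    rewrite map_col_mx; congr col_mx; apply/matrixP => i k; rewrite !mxE; exact: rmorph_nat.
  apply: (@rational_kernel_orthogonal R _ _ M); last first.
    rewrite MA A_S_mul; apply/matrixP => i j; rewrite !mxE; case: splitP => l _; rewrite !mxE.
      by rewrite marginB zu subrr.
    by rewrite marginB zu subrr.
  move=> e Me.
  (* The exponents of the binomial are the positive and negative parts of [e]. *)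
  pose a k := if (0 <= e k) then `|e k|%N else 0%N.
  pose b k := if (0 <= e k) then 0%N else `|e k|%N.
  have eab k : e k = (a k)%:Z - (b k)%:Z.
    by rewrite /a /b; case: (e k) => l; rewrite ?subr0// NegzE sub0r.
  have Aab : A_S R S *m (\col_k ((a k)%:R - (b k)%:R)) = 0.
    have : map_mx ratr (M *m (\col_k (e k)%:~R)) = 0 :> 'M[R]_(_, _).
      by rewrite Me map_mx0.
    rewrite map_mxM MA => <-; congr (_ *m _); apply/matrixP => k j; rewrite !mxE.
    by rewrite /= ratr_int eab intrB.
  have I := binomial_vanishing Aab.
  have dE (c : 'I_#|S| -> nat) k :
      eval_at (mderiv k (mpolyX R[i] (Multinom [tuple c k | k < #|S|]))) pc * v k 0 =
      (\prod_l pc l 0 ^+ c l) * ((c k)%:R * xi k).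
    rewrite mderivX /eval_at mevalZ mevalX mnmE vxi.
    have [->|ck] := eqVneq (c k) 0%N; first by rewrite !mul0r mulr0.
    rewrite (bigD1 k)//= [in RHS](bigD1 k)//= mnmBE mnmE mnm1E eqxx.
    have -> : \prod_(l | l != k) pc l 0 ^+ (mnm_sub (Multinom [tuple c k | k < #|S|]) (mnm1 k)) l =
              \prod_(l | l != k) pc l 0 ^+ c l.
      by apply: eq_bigr => l lk; rewrite mnmBE mnmE mnm1E eq_sym (negbTE lk) subn0.
    case: (c k) ck => // ck _; rewrite subn1/= exprS; ring.
  have := tv _ I; have := cl _ I.
  rewrite /eval_at mevalB !mevalX => /eqP; rewrite subr_eq0 => /eqP.
  under eq_bigr do rewrite mnmE; under [in RHS]eq_bigr do rewrite mnmE.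
  move=> ab; under eq_bigr => k _.
    rewrite mderivB -/(eval_at _ _) /eval_at mevalB mulrBl -!/(eval_at _ _) !dE -ab -mulrBr -mulrBl.
    over.
  rewrite -mulr_sumr => /eqP; rewrite mulf_eq0 => /orP[/eqP P0|/eqP E].
    by have /eqP[] : \prod_l pc l 0 ^+ a l != 0 by apply/prodf_neq0 => l _; rewrite expf_neq0.
  rewrite -[RHS]E; apply: eq_bigr => k _; rewrite eab intrB//.
transitivity (\sum_k (cell_vector (fun s => u s - rank_one z s) k 0)%:C * xi k +
   sig%:C * \sum_k v k 0); last by rewrite xi0 v0 mulr0 addr0.
rewrite mulr_sumr -big_split/=; apply: eq_bigr => k _.
have pcE : sig%:C * pc k 0 = (rank_one z (enum_val k))%:C.
  by rewrite !mxE -rmorphM/= mulrA mulfV// mul1r.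
have -> : map_mx (real_complex R) (cell_vector u) k 0 = (u (enum_val k))%:C by rewrite !mxE.
have -> : cell_vector (fun s => u s - rank_one z s) k 0 =
    u (enum_val k) - rank_one z (enum_val k) by rewrite mxE.
rewrite [X in _ + _ * X]vxi mulrA pcE -mulrDl -rmorphD/= subrK /xi.
by rewrite mulrA mulrAC.
Qed.

Lemma double_point_ml_degree (H : {set V}) (v0 : V) z z' :
  double_point S H v0 z z' -> ~ has_ml_degree R S 1.
Proof.
move=> dp; have [u0 [d [d0 open]]] := double_point_open dp.
move=> [g g0 gd].
have S0 : (0 < #|S|)%N.
  have [y [y' [_ _ _ [s sS _]]]] := open u0 (fun s => ltac:(by rewrite subrr normr0 ltW)).
  by apply/card_gt0P; exists s.
(* Signed data may have total 0, where [normalized] degenerates; multiplying [g] by the sum of the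
   variables avoids such data. *)
pose q : mpoly #|S| R[i] := \sum_(k < #|S|) mpolyX R[i] (mnm1 k).
have q0 : q != 0.
  apply/eqP => /(congr1 (mcoeff (mnm1 (Ordinal S0)))); rewrite mcoeff0 raddf_sum/=.
  rewrite (bigD1 (Ordinal S0))//= big1 ?addr0.
    by rewrite mcoeffX eqxx => /eqP; rewrite oner_eq0.
  by move=> k k0; rewrite mcoeffX; case: eqP => // /mnmP/(_ k); rewrite !mnm1E eqxx eq_sym (negbTE k0).
have [x xd gx] : exists2 x : 'I_#|S| -> R, (forall k, `|x k - u0 (enum_val k)| <= d) &
    meval (fun k => (x k)%:C) (g * q) != 0.
  apply: contrapT => nox; have /eqP := mulf_neq0 g0 q0; apply.
  apply: (mpoly_vanishing_box d0 (x0 := fun k => u0 (enum_val k))) => x xd.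
  by apply/eqP; apply: contrapT => /negP gx; apply: nox; exists x.
pose u s := if [pick k | enum_val k == s] is Some k then x k else u0 s.
have uE k : u (enum_val k) = x k.
  rewrite /u; case: pickP => [l /eqP/enum_val_inj ->//|/(_ k)]; by rewrite eqxx.
have [|y [y' [y0 ym y'm [s sS yy']]]] := open u _.
  move=> s; rewrite /u; case: pickP => [k /eqP <-//|_]; by rewrite subrr normr0 ltW.
have uc : (fun k => map_mx (real_complex R) (cell_vector u) k 0) = (fun k => (x k)%:C).
  by apply/funext => k; rewrite !mxE uE.
move: gx; rewrite mevalM mulf_eq0 negb_or => /andP[gx qx].
have {}qx : \sum_(s in S) u s != 0.
  rewrite -sum_cells; move: qx; rewrite raddf_sum/=; under eq_bigr do rewrite mevalXU -uE.
  by rewrite -rmorph_sum/= fmorph_eq0.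
(* The total depends only on the margins, so both solutions are rescaled by the same factor and stay
   distinct. *)
have total w : (forall v, margin S (rank_one w) v = margin S u v) ->
    \sum_(s in S) rank_one w s = \sum_(s in S) u s.
  move=> wm; have tE (f : 'I_m * 'I_n -> R) : \sum_(s in S) f s = \sum_i margin S f (inl i).
    under [RHS]eq_bigr do rewrite margin_row.
    by rewrite (partition_big fst predT).
  by rewrite !tE; apply: eq_bigr => i _; rewrite wm.
have crit w : (forall v, w v != 0) -> (forall v, margin S (rank_one w) v = margin S u v) ->
    critical_points (map_mx (real_complex R) (cell_vector u))
      (map_mx (real_complex R) (normalized w)).
  by move=> w0 wm; apply: normalized_critical => //; rewrite total.
have c1 := crit y (fun v => (y0 v).1) ym; have c2 := crit y' (fun v => (y0 v).2) y'm.
have := gd (map_mx (real_complex R) (cell_vector u)); rewrite /eval_at uc => /(_ gx).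
move=> /card_set_bijP[f fb].
have /(congr1 (fun M : 'cV[R[i]]_#|S| => M (enum_rank_in sS s) 0)) :
    map_mx (real_complex R) (normalized y) = map_mx (real_complex R) (normalized y').
  apply: (set_bij_inj fb); rewrite ?inE//.
  have := set_bij_sub fb; move=> fs.
  have := fs _ (imageP f c1); have := fs _ (imageP f c2).
  by rewrite /= !ltnS !leqn0 => /eqP -> /eqP ->.
rewrite !mxE => /complexI; rewrite (total _ ym) (total _ y'm) => /mulfI.
rewrite invr_eq0 => /(_ qx); rewrite enum_rankK_in// => yE.
by rewrite yE eqxx in yy'.
Qed.

End CriticalPoints.

(** * Closed walks and additive functions *)

Section Walks.
Variables (R : zmodType) (V : finType) (e : rel V) (g : V -> V -> R).
Hypotheses (e_sym : symmetric e) (g_anti : forall v w, g w v = - g v w).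
Implicit Types (w : nat -> V) (L : nat).

Definition walk L w := forall i, (i < L)%N -> e (w i) (w i.+1).
Definition walk_sum L w := \sum_(0 <= i < L) g (w i) (w i.+1).
Definition walk_cat L w w' i := if (i <= L)%N then w i else w' (i - L)%N.

Lemma walk_catE L w w' i : w L = w' 0%N -> walk_cat L w w' (L + i) = w' i.
Proof.
move=> ww'; rewrite /walk_cat; case: i => [|i]; first by rewrite addn0 leqnn.
by rewrite -[X in (_ <= X)%N]addn0 leq_add2l addKn.
Qed.

Lemma walk_walk_cat L L' w w' :
  w L = w' 0%N -> walk L w -> walk L' w' -> walk (L + L') (walk_cat L w w').
Proof.
move=> ww' Hw Hw' i iL; have [il|li] := ltnP i L; first by rewrite /walk_cat il ltnW// Hw.
rewrite -(subnKC li) -addnS !walk_catE//; apply: Hw'.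
by rewrite ltn_subLR.
Qed.

Lemma walk_sum_cat L L' w w' : w L = w' 0%N ->
  walk_sum (L + L') (walk_cat L w w') = walk_sum L w + walk_sum L' w'.
Proof.
move=> ww'; rewrite /walk_sum (@big_cat_nat _ _ _ L)/= ?leq_addr//; congr (_ + _).
  by apply: eq_big_nat => i /andP[_ il]; rewrite /walk_cat il ltnW.
rewrite -{1}[L]add0n big_addn addKn; apply: eq_bigr => i _.
by rewrite addnC -addnS !walk_catE.
Qed.

Lemma walk_rev L w : walk L w -> walk L (fun i => w (L - i)%N).
Proof.
move=> Hw i iL; rewrite e_sym; have := Hw (L - i.+1)%N; rewrite -subSn// subSS.
by apply; exact: leq_subr.
Qed.

Lemma walk_sum_rev L w : walk_sum L (fun i => w (L - i)%N) = - walk_sum L w.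
Proof.
rewrite /walk_sum -sumrN [RHS]big_nat_rev/= add0n; apply: eq_big_nat => i /andP[_ iL].
by rewrite -subSn// subSS -g_anti.
Qed.

Lemma walk_shift a L w : walk (a + L) w -> walk L (fun i => w (a + i)%N).
Proof. by move=> Hw i iL; rewrite addnS; apply: Hw; rewrite ltn_add2l. Qed.

Lemma walk_sum_shift a L w :
  walk_sum (a + L) w = walk_sum a w + walk_sum L (fun i => w (a + i)%N).
Proof.
rewrite /walk_sum (@big_cat_nat _ _ _ a)/= ?leq_addr//; congr (_ + _).
by rewrite -{1}[a]add0n big_addn addKn; apply: eq_bigr => i _; rewrite addnC addnS.
Qed.

(** [la v] is the sum along a chosen walk from the root of the component to [v]; for an edge [v x],
    the two chosen walks and the edge close up. *)
Lemma potential_of_closed_walks :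
  (forall L w, walk L w -> w L = w 0%N -> walk_sum L w = 0) ->
  exists la : V -> R, forall v x, e v x -> la x - la v = g v x.
Proof.
move=> closed0; have cs := sym_connect_sym e_sym.
pose rt := fingraph.root e.
have wex v : exists x : R, exists L w, [/\ walk L w, w 0%N = rt v, w L = v & walk_sum L w = x].
  have : connect e (rt v) v by rewrite cs connect_root.
  move=> /connectP[p /(pathP v) pP vE].
  exists (walk_sum (size p) (nth v (rt v :: p))); exists (size p), (nth v (rt v :: p)).
  split=> //; last by rewrite [RHS]vE (last_nth v).
have [la laP] := choice wex.
exists la => v x vx.
have [L [p [pw p0 pL <-]]] := laP v; have [L' [p' [pw' p0' pL' <-]]] := laP x.
have rvw : rt v = rt x by apply/eqP; rewrite (root_connect cs) connect1.
pose st i := if i is 0%N then v else x.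
have pst : p L = st 0%N by [].
pose q := walk_cat L p st.
have qL : q L.+1 = x by rewrite /q -addn1 walk_catE.
have wq : walk L.+1 q by rewrite -addn1; apply: walk_walk_cat => // -[].
have sq : walk_sum L.+1 q = walk_sum L p + g v x.
  by rewrite -addn1 walk_sum_cat// /walk_sum [X in _ + X]big_nat1.
pose rv i := p' (L' - i)%N.
have qrv : q L.+1 = rv 0%N by rewrite qL /rv subn0.
have := closed0 _ _ (walk_walk_cat qrv wq (walk_rev pw')).
rewrite walk_catE// /rv subnn p0' -rvw -p0 => /(_ erefl).
rewrite walk_sum_cat// walk_sum_rev sq => /eqP.
by rewrite subr_eq0 => /eqP <-; rewrite addrAC subrr add0r.
Qed.

(** A repeated vertex or a chord cuts a closed walk into two shorter closed walks with the same
    total sum, the chord being traversed once in each direction. A nonzero sum therefore forces a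
    chordless cycle. *)
Lemma closed_walk_sum_split L w : walk L w -> w L = w 0%N ->
  (forall L' w', (L' < L)%N -> walk L' w' -> w' L' = w' 0%N -> walk_sum L' w' = 0) ->
  walk_sum L w = 0 \/
  [/\ forall i j, (i < j < L)%N -> w i <> w j &
      forall i j, (i < j < L)%N -> e (w i) (w j) -> j = i.+1 \/ (i = 0%N /\ j.+1 = L)].
Proof.
move=> Hw wL IH; have [->|s0] := eqVneq (walk_sum L w) 0; [by left|right].
split=> i j /andP[ij jL].
  move=> wij; case/eqP: s0.
  pose M := (L - j)%N; have LE : L = (i + (j - i) + M)%N by rewrite subnKC ?subnKC ?(ltnW ij) ?(ltnW jL).
  have Wi : walk i w by move=> k ki; apply: Hw; rewrite (ltn_trans ki)// (ltn_trans ij).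
  have W1 : walk (j - i) (fun k => w (i + k)%N).
    by apply: walk_shift; rewrite subnKC ?(ltnW ij)// => k kj; apply: Hw; rewrite (ltn_trans kj).
  have W2 : walk M (fun k => w (j + k)%N).
    by apply: walk_shift; rewrite /M subnKC// ltnW.
  have s1 : walk_sum (j - i) (fun k => w (i + k)%N) = 0.
    apply: IH => //; last by rewrite subnKC ?addn0 ?(ltnW ij).
    by rewrite (leq_ltn_trans _ jL)// leq_subr.
  have iw : w i = (fun k => w (j + k)%N) 0%N by rewrite addn0.
  have s2 : walk_sum i w + walk_sum M (fun k => w (j + k)%N) = 0.
    rewrite -walk_sum_cat//; apply: IH; last 1 first.
    - by rewrite walk_catE// /M subnKC ?(ltnW jL)// /walk_cat leq0n.
    - by rewrite LE ltn_add2r -[X in (X < _)%N]addn0 ltn_add2l subn_gt0.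
    - exact: walk_walk_cat.
  rewrite LE walk_sum_shift [X in X + _]walk_sum_shift s1 addr0 subnKC ?(ltnW ij)//.
move=> eij; have [->|ji] := eqVneq j i.+1; [by left|right].
apply: contrapT => nclose; case/eqP: s0.
pose M := (L - j)%N; have LE : L = (i + (j - i) + M)%N by rewrite subnKC ?subnKC ?(ltnW ij) ?(ltnW jL).
have j2 : (2 <= j - i)%N by rewrite ltn_subRL addn1 ltn_neqAle eq_sym ji.
(* This fails only if the chord is the closing edge from the last vertex to the first, which
   [nclose] excludes. *)
have short : ((j - i).+1 < L)%N.
  rewrite ltn_neqAle (leq_ltn_trans (leq_subr _ _) jL) andbT; apply/eqP => E.
  apply: nclose; have i0 : i = 0%N.
    move: jL; rewrite -E ltnS => jji; apply/eqP; rewrite -leqn0 -(leq_add2l (j - i)) addn0.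
    by rewrite subnK ?(ltnW ij).
  by split=> //; rewrite -E i0 subn0.
have Wi : walk i w by move=> k ki; apply: Hw; rewrite (ltn_trans ki)// (ltn_trans ij).
have W1 : walk (j - i) (fun k => w (i + k)%N).
  by apply: walk_shift; rewrite subnKC ?(ltnW ij)// => k kj; apply: Hw; rewrite (ltn_trans kj).
have W2 : walk M (fun k => w (j + k)%N).
  by apply: walk_shift; rewrite /M subnKC// ltnW.
pose st k := if k is 0%N then w i else w j.
pose ts k := if k is 0%N then w j else w i.
have wst : walk 1 st by case.
have wts : walk 1 ts by case=> // _; rewrite /ts e_sym.
have e1 : (fun k => w (i + k)%N) (j - i)%N = ts 0%N by rewrite subnKC ?(ltnW ij).
have s1 : walk_sum (j - i) (fun k => w (i + k)%N) = g (w i) (w j).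
  have := IH _ _ short; rewrite -addn1 => /(_ _ (walk_walk_cat e1 W1 wts)).
  have -> : walk_cat (j - i) (fun k => w (i + k)%N) ts 0%N = w i by rewrite /walk_cat leq0n addn0.
  have ts1 : walk_sum 1 ts = - g (w i) (w j) by rewrite /walk_sum big_nat1 /= g_anti.
  by rewrite walk_catE// walk_sum_cat// ts1 => /(_ erefl)/eqP; rewrite subr_eq0 => /eqP.
have e2 : w i = st 0%N by [].
have e3 : walk_cat i w st (i + 1) = (fun k => w (j + k)%N) 0%N by rewrite walk_catE// addn0.
have s2 : walk_sum i w + g (w i) (w j) + walk_sum M (fun k => w (j + k)%N) = 0.
  have -> : g (w i) (w j) = walk_sum 1 st by rewrite /walk_sum big_nat1.
  rewrite -walk_sum_cat// -walk_sum_cat//; apply: IH.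
  - by rewrite [X in (_ < X)%N]LE ltn_add2r ltn_add2l.
  - by apply: walk_walk_cat => //; apply: walk_walk_cat.
  - by rewrite walk_catE// /M subnKC ?(ltnW jL)// /walk_cat leq0n.
rewrite LE walk_sum_shift [X in X + _]walk_sum_shift s1.
by rewrite subnKC ?(ltnW ij).
Qed.
End Walks.

Section AdditiveFunctions.
Variables (R : realType) (m n : nat) (S : {set 'I_m * 'I_n}).
Notation V := ('I_m + 'I_n)%type.

(** [f] is additive once the antisymmetric edge function [g] is a difference of potentials. A
    shortest closed walk with nonzero sum would be chordless and, by bipartiteness, of even length:
    length 0 or 2 cancels, length 4 is a rectangle, longer ones are excluded. *)
Lemma additive_of_rectangles (f : 'I_m * 'I_n -> R) :
  (forall K v, (1 < K)%N -> ~ chordless_cycle S K.*2.+2 v) ->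
  (forall i i' j j', (i, j) \in S -> (i, j') \in S -> (i', j) \in S -> (i', j') \in S ->
     f (i, j) + f (i', j') = f (i, j') + f (i', j)) ->
  exists (al : 'I_m -> R) (be : 'I_n -> R),
    forall s, s \in S -> f s = al s.1 + be s.2.
Proof.
move=> nocycle rect.
pose g (v w : V) : R := match v, w with
  | inl i, inr j => f (i, j) | inr j, inl i => - f (i, j) | _, _ => 0 end.
have g_anti v w : g w v = - g v w by case: v; case: w => /= *; rewrite ?oppr0 ?opprK.
suff [la laP] : exists la : V -> R, forall v w, cell_adj S v w -> la w - la v = g v w.
  exists (fun i => - la (inl i)), (fun j => la (inr j)) => -[i j] ij /=.
  by have := laP (inl i) (inr j) ij; rewrite /= => <-; rewrite addrC.
apply: (potential_of_closed_walks (@cell_adj_sym m n S)) => // L.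
have [k] := ubnP L; elim: k L => // k IH L Lk w Hw wL.
have [|//|[inj chord]] := closed_walk_sum_split (@cell_adj_sym m n S) g_anti Hw wL.
  by move=> L' w' L'L; apply: IH; rewrite (leq_trans L'L).
pose col (v : V) := if v is inl _ then true else false.
have cadj v v' : cell_adj S v v' -> col v' = ~~ col v by case: v; case: v'.
have cE i : (i <= L)%N -> col (w i) = col (w 0%N) (+) odd i.
  elim: i => [_|i IHi iL]; first by rewrite addbF.
  by rewrite (cadj _ _ (Hw _ iL)) IHi ?(ltnW iL)// addbN.
have Leven : ~~ odd L.
  by have := cE L (leqnn _); rewrite wL; case: (odd L) => //; case: (col _).
case: L Leven Lk Hw wL inj chord cE => [|[|[|[|[|[|L]]]]]] // Leven Lk Hw wL inj chord cE.
- by rewrite /walk_sum big_nil.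
- by rewrite /walk_sum !big_nat_recl// big_nil wL g_anti addr0 addNr.
- rewrite /walk_sum !big_nat_recl// big_nil wL.
  have := Hw 0%N isT; have := Hw 1%N isT; have := Hw 2%N isT; have := Hw 3%N isT.
  rewrite wL; case: (w 0%N) (w 1%N) (w 2%N) (w 3%N) => a [] b// [] c// [] d//= h1 h2 h3 h4.
    by have := @rect a c b d; rewrite h1 h2 h3 h4 => /(_ isT isT isT isT); lra.
  by have := @rect b d a c; rewrite h1 h2 h3 h4 => /(_ isT isT isT isT); lra.
(* The length is now [L + 6], that is [2 * K + 2] with [K = L / 2 + 2]. *)
case: (nocycle (L./2).+2 w) => //.
have -> : ((L./2).+2).*2.+2 = L.+4.+2.
  by rewrite !doubleS -{2}[L]odd_double_half; move: Leven; rewrite /= !negbK => /negbTE ->.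
split=> [i j iL jL wij|i j iL jL].
  case: (ltngtP i j) => // h; first by case: (inj i j); rewrite ?h.
  by case: (inj j i); rewrite ?h.
have fwd a b : (a < L.+4.+2)%N -> (b < L.+4.+2)%N -> b = (a.+1 %% L.+4.+2)%N ->
    cell_adj S (w a) (w b).
  move=> aL bL ->; have := Hw a aL; move: (aL); rewrite leq_eqVlt => /orP[/eqP E|a1L].
    by rewrite E modnn wL.
  by rewrite modn_small.
have bwd a b : (a < b < L.+4.+2)%N -> cell_adj S (w a) (w b) ->
    (b == a.+1 %% L.+4.+2)%N || (a == b.+1 %% L.+4.+2)%N.
  move=> /andP[ab bL] wab; have [->|[-> bE]] := chord a b (introT andP (conj ab bL)) wab.
    by rewrite modn_small ?eqxx// (leq_ltn_trans ab).
  by rewrite bE modnn eqxx orbT.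
apply/idP/orP => [wij|[/eqP|/eqP]]; last first.
- by rewrite cell_adj_sym; exact: fwd.
- exact: fwd.
case: (ltngtP i j) => h; first by apply/orP; apply: bwd; rewrite ?h.
  by apply/orP; rewrite orbC; apply: bwd; rewrite ?h// cell_adj_sym.
by move: wij; rewrite h; case: (w j).
Qed.
End AdditiveFunctions.

(** * The laminar family of traces *)

Section Nodes.
Variables (m n : nat) (S : {set 'I_m * 'I_n}).
Notation set0 := finset.set0.
Implicit Types (r : 'I_m) (c : 'I_n) (T P F X : {set 'I_n}).

Definition nbr r : {set 'I_n} := [set c | (r, c) \in S].

(* Singletons are adjoined so that the tree of traces in each row goes down to
   single columns. *)
Definition family : {set {set 'I_n}} :=
  [set nbr r | r : 'I_m] :|: [set [set c] | c : 'I_n].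

Definition node_of r T := (T != set0) && [exists F in family, T == nbr r :&: F].

Definition node T := [exists r, node_of r T].

Definition common T : {set 'I_m} := [set r | T \subset nbr r].

(** Phrased without a row, so that the classes are the same in all rows of [common T]. By laminarity
    they are the maximal traces strictly inside [T]. *)
Definition subclass T c : {set 'I_n} :=
  [set c' in T | [exists F in family, [&& ~~ (T \subset F), c \in F & c' \in F]]].

Definition domino_free := forall r r' r'' c c' c'',
  (r, c) \in S -> (r, c') \in S -> (r, c'') \in S ->
  (r', c) \in S -> (r', c') \in S -> (r', c'') \notin S ->
  (r'', c) \in S -> (r'', c') \notin S -> (r'', c'') \in S -> False.

Hypothesis Sdf : domino_free.

Lemma node_ofP r T : reflect (T != set0 /\ exists2 F, F \in family & T = nbr r :&: F) (node_of r T).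
Proof.
apply: (iffP andP) => -[T0].
  by move=> /existsP[F /andP[Ff /eqP]]; split=> //; exists F.
by move=> [F Ff TE]; split=> //; apply/existsP; exists F; rewrite Ff; apply/eqP.
Qed.

Lemma nbr_family r : nbr r \in family.
Proof. by rewrite !inE; apply/orP; left; apply: imset_f. Qed.

Lemma set1_family c : [set c] \in family.
Proof. by rewrite !inE; apply/orP; right; apply: imset_f. Qed.

(** Two crossing traces through [c] exhibit a domino on the rows [r], [r1], [r2] and the columns
    [c], [c1], [c2]; a singleton cannot cross anything. *)
Lemma family_laminar r F F' c : F \in family -> F' \in family ->
  c \in nbr r :&: F -> c \in nbr r :&: F' ->
  (nbr r :&: F \subset nbr r :&: F') || (nbr r :&: F' \subset nbr r :&: F).
Proof.
move=> Ff F'f cF cF'; apply/orP; apply: contrapT => /not_orP[/negP/fintype.subsetPn[c1 c1F c1F'] ].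
move=> /negP/fintype.subsetPn[c2 c2F' c2F].
have sing (X : {set 'I_n}) d d' : [set d] = X -> d' \in X -> d' = d by move=> <-; rewrite inE => /eqP.
move: cF cF' c1F c1F' c2F' c2F; rewrite !finset.in_setI => /andP[cr cF] /andP[_ cF'] /andP[c1r c1F].
rewrite c1r /= => c1F' /andP[c2r c2F']; rewrite c2r /= => c2F.
move: Ff F'f; rewrite !inE => /orP[/imsetP[r1 _ E1]|/imsetP[d _ E1]]; last first.
  by move: c1F'; rewrite (sing _ _ _ (esym E1) c1F) -(sing _ _ _ (esym E1) cF) cF'.
move=> /orP[/imsetP[r2 _ E2]|/imsetP[d _ E2]]; last first.
  by move: c2F; rewrite (sing _ _ _ (esym E2) c2F') -(sing _ _ _ (esym E2) cF') cF.
move: cr c1r c2r cF cF' c1F c1F' c2F c2F'; rewrite E1 E2 !inE => *.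
by apply: (@Sdf r r1 r2 c c1 c2).
Qed.

Lemma node_of_laminar r T T' c : node_of r T -> node_of r T' -> c \in T -> c \in T' ->
  (T \subset T') || (T' \subset T).
Proof.
move=> /node_ofP[_ [F Ff ->]] /node_ofP[_ [F' F'f ->]]; exact: family_laminar.
Qed.

Lemma node_of_sub r T : node_of r T -> T \subset nbr r.
Proof. by move=> /node_ofP[_ [F _ ->]]; rewrite finset.subsetIl. Qed.

Lemma node_of_neq0 r T : node_of r T -> T != set0.
Proof. by case/andP. Qed.

Lemma node_of_trace r F c : F \in family -> c \in nbr r -> c \in F -> node_of r (nbr r :&: F).
Proof.
move=> Ff cr cF; apply/node_ofP; split; last by exists F.
by apply/finset.set0Pn; exists c; rewrite finset.in_setI cr.
Qed.

(** In row [r1] the traces of [F] and of [nbr r] are nested, so the smaller one is their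
    intersection, and that is [T]. *)
Lemma node_of_transport r r1 T : node_of r T -> T \subset nbr r1 -> node_of r1 T.
Proof.
move=> nT Tr1; have Tr := node_of_sub nT.
have /finset.set0Pn[c cT] := node_of_neq0 nT.
have /node_ofP[_ [F Ff TE]] := nT.
have TF : T \subset F by rewrite TE finset.subsetIr.
have cr := fintype.subsetP Tr _ cT; have cr1 := fintype.subsetP Tr1 _ cT; have cF := fintype.subsetP TF _ cT.
have cI (G : {set 'I_n}) : c \in G -> c \in nbr r1 :&: G by rewrite finset.in_setI cr1.
have := family_laminar Ff (nbr_family r) (cI _ cF) (cI _ cr).
move=> /orP[sub|sub].
  have -> : T = nbr r1 :&: F; last exact: node_of_trace Ff cr1 cF.
  apply/eqP; rewrite finset.eqEsubset finset.subsetI Tr1 TF /= {1}TE finset.subsetI finset.subsetIr andbT.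
  by rewrite (fintype.subset_trans sub)// finset.subsetIr.
have -> : T = nbr r1 :&: nbr r; last exact: node_of_trace (nbr_family r) cr1 cr.
apply/eqP; rewrite finset.eqEsubset finset.subsetI Tr1 Tr /= {1}TE finset.subsetI finset.subsetIr /=.
by rewrite (fintype.subset_trans sub)// finset.subsetIr.
Qed.

Lemma node_common T r : node T -> r \in common T -> node_of r T.
Proof. by move=> /existsP[r0 nT]; rewrite inE; exact: node_of_transport nT. Qed.

Lemma node_has_common T : node T -> exists r, r \in common T.
Proof. by move=> /existsP[r0 /node_of_sub nT]; exists r0; rewrite inE. Qed.

Lemma node_of_node r T : node_of r T -> node T.
Proof. by move=> nT; apply/existsP; exists r. Qed.

Lemma subclass_sub T c : subclass T c \subset T.
Proof. by apply/fintype.subsetP => c'; rewrite inE => /andP[]. Qed.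

Lemma subclassP T c c' : reflect (c' \in T /\ exists F,
   [/\ F \in family, ~~ (T \subset F), c \in F & c' \in F]) (c' \in subclass T c).
Proof.
rewrite inE; apply: (iffP andP) => -[c'T].
  by move=> /existsP[F /and4P[? ? ? ?]]; split=> //; exists F.
by move=> [F [? ? ? ?]]; split=> //; apply/existsP; exists F; apply/and4P.
Qed.

Lemma subclass_refl T c : (1 < #|T|)%N -> c \in T -> c \in subclass T c.
Proof.
move=> T1 cT; apply/subclassP; split=> //; exists [set c]; split; rewrite ?set1_family ?inE//.
by apply: contraL T1 => /subset_leq_card; rewrite cards1 -leqNgt.
Qed.

Lemma subclass_trans T c c' : node T -> c \in T -> c' \in subclass T c ->
  subclass T c' \subset subclass T c.
Proof.
move=> /existsP[r nT] cT /subclassP[c'T [F1 [F1f TF1 cF1 c'F1]]].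
apply/fintype.subsetP => d /subclassP[dT [F2 [F2f TF2 c'F2 dF2]]].
have Tr := fintype.subsetP (node_of_sub nT).
have inI x (F : {set 'I_n}) : x \in T -> x \in F -> x \in nbr r :&: F by move=> xT xF; rewrite finset.in_setI Tr.
have := family_laminar F1f F2f (inI _ _ c'T c'F1) (inI _ _ c'T c'F2).
move=> /orP[/fintype.subsetP/(_ _ (inI _ _ cT cF1))|/fintype.subsetP/(_ _ (inI _ _ dT dF2))];
  rewrite finset.in_setI => /andP[_ h]; apply/subclassP; split=> //.
  by exists F2.
by exists F1.
Qed.

Lemma subclass_sym T c c' : c \in T -> c' \in subclass T c -> c \in subclass T c'.
Proof.
by move=> cT /subclassP[c'T [F [Ff TF cF c'F]]]; apply/subclassP; split=> //; exists F.
Qed.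

Lemma subclass_eq T c c' : node T -> c \in T -> c' \in subclass T c ->
  subclass T c' = subclass T c.
Proof.
move=> nT cT cc'; apply/eqP; rewrite finset.eqEsubset subclass_trans//.
by apply: subclass_trans => //; [exact: (fintype.subsetP (subclass_sub _ _) _ cc')|exact: subclass_sym].
Qed.

Lemma trace_subclass T F r c : node_of r T -> F \in family -> ~~ (T \subset F) ->
  c \in T -> c \in F -> nbr r :&: F \subset subclass T c.
Proof.
move=> nT Ff TF cT cF; have cr := fintype.subsetP (node_of_sub nT) _ cT.
have cI : c \in nbr r :&: F by rewrite finset.in_setI cr.
have := node_of_laminar nT (node_of_trace Ff cr cF) cT cI.
rewrite finset.subsetI (negbTE TF) andbF /= => sub; apply/fintype.subsetP => d dI.
apply/subclassP; split; first exact: (fintype.subsetP sub).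
by exists F; move: dI; rewrite finset.in_setI => /andP[_ ->].
Qed.

Lemma node_subclass P T c : node P -> node T -> (exists2 r, r \in common P & r \in common T) ->
  T \proper P -> c \in T -> T \subset subclass P c.
Proof.
move=> nP nT [r rP rT] /andP[TP PT] cT.
have nrP := node_common nP rP; have /node_ofP[_ [F Ff TE]] := node_common nT rT.
have cF : c \in F by move: cT; rewrite TE finset.in_setI => /andP[].
rewrite TE; apply: trace_subclass => //; last exact: (fintype.subsetP TP).
by apply: contra PT => PF; rewrite TE finset.subsetI (node_of_sub nrP).
Qed.

(** The value [T] flags the rows equal to [T], above which the row has no larger node. *)
Definition parent T r :=
  if nbr r == T then T else [arg min_(P < nbr r | node_of r P && (T \proper P)) #|P|].

Lemma parent_prop T r : node T -> r \in common T -> nbr r != T ->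
  [/\ node_of r (parent T r), T \proper parent T r &
      forall P, node_of r P -> T \proper P -> parent T r \subset P].
Proof.
move=> nT rT nrT; have nrT' := node_common nT rT.
have /finset.set0Pn[c cT] := node_of_neq0 nrT'.
have Tr := node_of_sub nrT'; have cr := fintype.subsetP Tr _ cT.
have h0 : node_of r (nbr r) && (T \proper nbr r).
  rewrite finset.properEneq eq_sym nrT Tr !andbT.
  by have := node_of_trace (nbr_family r) cr cr; rewrite finset.setIid.
rewrite /parent (negbTE nrT); case: arg_minnP => // P /andP[nP TP] Pmin.
split=> // P' nP' TP'; have := Pmin P'; rewrite nP' TP' => /(_ isT) card.
have cP := fintype.subsetP (fintype.proper_sub TP) _ cT; have cP' := fintype.subsetP (fintype.proper_sub TP') _ cT.
have := node_of_laminar nP nP' cP cP' => /orP[//|sub].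
by have /eqP -> : P' == P by rewrite finset.eqEcard sub.
Qed.

(** Nodes are transported between [r] and [r1], so both minima agree. Consequently the rows with a
    given parent [P] strictly above [T] are all of [common P]. *)
Lemma parent_same T r r1 : node T -> r \in common T -> nbr r != T ->
  parent T r \subset nbr r1 -> r1 \in common T /\ parent T r1 = parent T r.
Proof.
move=> nT rT nrT Pr1; have [nP TP Pmin] := parent_prop nT rT nrT.
have r1T : r1 \in common T by rewrite inE (fintype.subset_trans (fintype.proper_sub TP)).
have nr1T : nbr r1 != T.
  apply: contraTneq TP => r1E; rewrite fintype.properE negb_and negbK; apply/orP; right.
  by apply: fintype.subset_trans Pr1 _; rewrite r1E.
split=> //; have [nP1 TP1 P1min] := parent_prop nT r1T nr1T.
have sub := P1min _ (node_of_transport nP Pr1) TP.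
apply/eqP; rewrite finset.eqEsubset sub Pmin//.
by apply: node_of_transport nP1 _; rewrite (fintype.subset_trans sub)// node_of_sub.
Qed.

(** A trace that meets [T] and leaves it contains [T] strictly, hence contains the parent by
    minimality, and so does not count in [subclass]. *)
Lemma parent_subclass T r c : node T -> r \in common T -> nbr r != T -> c \in T ->
  subclass (parent T r) c = T.
Proof.
move=> nT rT nrT cT; have [nP TP Pmin] := parent_prop nT rT nrT.
apply/eqP; rewrite finset.eqEsubset node_subclass ?(node_of_node nP)//; last first.
  by exists r => //; rewrite inE node_of_sub.
rewrite andbT; apply/fintype.subsetP => d /subclassP[dP [F [Ff PF cF dF]]].
have cP := fintype.subsetP (fintype.proper_sub TP) _ cT.
have cr := fintype.subsetP (node_of_sub nP) _ cP; have dr := fintype.subsetP (node_of_sub nP) _ dP.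
have nX := node_of_trace Ff cr cF.
have cX : c \in nbr r :&: F by rewrite finset.in_setI cr.
have dX : d \in nbr r :&: F by rewrite finset.in_setI dr.
have := node_of_laminar (node_common nT rT) nX cT cX => /orP[TX|/fintype.subsetP/(_ _ dX)//].
apply: contraNT PF => dT; have TpX : T \proper nbr r :&: F.
  by apply/properP; split=> //; exists d.
by rewrite (fintype.subset_trans (Pmin _ nX TpX))// finset.subsetIr.
Qed.

(* The rows containing [T] are partitioned by the parent of [T] in each row. *)
Lemma node_sum0 (R : zmodType) (d : 'I_m * 'I_n -> R) T : node T ->
  (forall r, \sum_(c in nbr r) d (r, c) = 0) ->
  (forall P c, node P -> (#|T| < #|P|)%N -> c \in P ->
     \sum_(r in common P) \sum_(c' in subclass P c) d (r, c') = 0) ->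
  \sum_(r in common T) \sum_(c in T) d (r, c) = 0.
Proof.
move=> nT rows0 class0; have [r0 r0T] := node_has_common nT.
have /finset.set0Pn[c cT] := node_of_neq0 (node_common nT r0T).
rewrite (partition_big (parent T) predT)//= big1// => P _.
have [/existsP[r /andP[rT /eqP rP]]|/existsPn none] :=
  boolP [exists r, (r \in common T) && (parent T r == P)]; last first.
  by rewrite big_pred0// => r; apply/negbTE/none.
have [rE|nrT] := eqVneq (nbr r) T.
  have PE : P = T by rewrite -rP /parent rE eqxx.
  apply: big1 => r1 /andP[r1T]; rewrite PE => /eqP r1P.
  suff <- : nbr r1 = T by exact: rows0.
  apply/eqP; apply: contraT => nr1T; have [_ + _] := parent_prop nT r1T nr1T.
  by rewrite r1P fintype.properxx.
have [nP TP _] := parent_prop nT rT nrT; rewrite rP in nP TP.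
(* The group of rows is all of [common P] and [T] is one class of [P], so this part of the sum is a
   class sum of a larger node. *)
rewrite (eq_bigl (mem (common P))); last first.
  move=> r1 /=; apply/andP/idP => [[r1T /eqP r1P]|].
    rewrite inE -r1P; have [r1E|nr1T] := eqVneq (nbr r1) T; last first.
      by have [n1 _ _] := parent_prop nT r1T nr1T; exact: node_of_sub.
    by move: TP; rewrite -r1P /parent r1E eqxx fintype.properxx.
  rewrite inE -rP => /(parent_same nT rT nrT)[-> ->]; by rewrite eqxx.
have := class0 P c (node_of_node nP) (fintype.proper_card TP) (fintype.subsetP (fintype.proper_sub TP) _ cT).
by rewrite -rP (parent_subclass nT rT nrT cT).
Qed.

End Nodes.

(** * Scaling by one block *)

Section OneCycle.
Variables (R : realType) (m n : nat) (S : {set 'I_m * 'I_n}).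
Notation set0 := finset.set0.
Notation cell := ('I_m * 'I_n)%type.
Notation nbr := (nbr S).
Notation node := (node S).
Notation common := (common S).
Notation subclass := (subclass S).
Implicit Types (u q : cell -> R) (T P : {set 'I_n}).

Hypothesis Sdf : domino_free S.
Hypothesis Sncc : forall K v, (1 < K)%N -> ~ chordless_cycle S K.*2.+2 v.

Definition additive_on (f : cell -> R) :=
  exists (al : 'I_m -> R) (be : 'I_n -> R), forall s, s \in S -> f s = al s.1 + be s.2.

(* A block is encoded by the map sending a cell to its class. *)
Definition row_block (s : cell) : {set cell} := [set t in S | t.1 == s.1].

(** The cells outside [common T * T] form one extra class, which completes the partition of [S]. *)
Definition node_block T (s : cell) : {set cell} :=
  if (s.1 \in common T) && (s.2 \in T) then finset.setX (common T) (subclass T s.2)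
  else S :\: finset.setX (common T) T.

(** The second clause puts the class indicators in the row span of [A_S] and keeps scaled tables
    log-additive. *)
Definition block (ka : cell -> {set cell}) : Prop :=
  (forall s, s \in S -> [/\ s \in ka s, ka s \subset S & forall t, t \in ka s -> ka t = ka s]) /\
  (forall h : {set cell} -> R, additive_on (h \o ka)).

Lemma common_sub T r c : r \in common T -> c \in T -> (r, c) \in S.
Proof. by rewrite inE => /fintype.subsetP Tr /Tr; rewrite inE. Qed.

Lemma row_blockP : block row_block.
Proof.
split=> [s sS|h]; last first.
  exact: additive_of_rectangles.
split; first by rewrite inE sS eqxx.
  by apply/fintype.subsetP => t; rewrite inE => /andP[].
by move=> t; rewrite inE => /andP[_ /eqP ts]; rewrite /row_block ts.
Qed.

(** Additivity is checked on rectangles. The critical ones have one row in [common T] and one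
    outside: the second row cuts a trace not containing [T], so as soon as one column lies in [T],
    both lie in the same subclass. *)
Lemma node_blockP T : node T -> (1 < #|T|)%N -> block (node_block T).
Proof.
move=> nT T1; split=> [[r0 c0] sS|h].
  rewrite /node_block; case: ifPn => [/andP[s1 s2]|sT]; split.
  - by rewrite finset.in_setX s1 subclass_refl.
  - apply/fintype.subsetP => -[r c]; rewrite finset.in_setX => /andP[/= r1 /(fintype.subsetP (subclass_sub _ _ _))].
    exact: common_sub.
  - move=> [r c]; rewrite finset.in_setX => /andP[/= -> cs] /=.
    by rewrite (fintype.subsetP (subclass_sub _ _ _) _ cs) (subclass_eq Sdf nT s2 cs).
  - by rewrite finset.in_setD sS andbT finset.in_setX.
  - exact: finset.subsetDl.
  - by move=> [r c]; rewrite finset.in_setD finset.in_setX => /andP[/negbTE -> _].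
apply: additive_of_rectangles => // i i' j j' e1 e2 e3 e4.
rewrite /= /node_block /=.
have key r r' c c' : r \in common T -> r' \notin common T -> c \in T ->
    (r, c) \in S -> (r, c') \in S -> (r', c) \in S -> (r', c') \in S ->
    c' \in T /\ subclass T c' = subclass T c.
  move=> rT r'T cT rc rc' r'c r'c'.
  have cc' : c' \in subclass T c.
    apply: (fintype.subsetP (trace_subclass Sdf (node_common Sdf nT rT) (nbr_family S r') _ cT _)).
    - by move: r'T; rewrite inE.
    - by rewrite inE.
    - by rewrite finset.in_setI !inE rc'.
  by split; [exact: (fintype.subsetP (subclass_sub _ _ _) _ cc')|exact: subclass_eq].
case: (boolP (i \in common T)) => iT; case: (boolP (i' \in common T)) => i'T /=.
- by rewrite addrC.
- have [jT|jT] := boolP (j \in T); have [j'T|j'T] := boolP (j' \in T) => //.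
  + by have [_ ->] := key _ _ _ _ iT i'T jT e1 e2 e3 e4.
  + by have [] := key _ _ _ _ iT i'T jT e1 e2 e3 e4; rewrite (negbTE j'T).
  + by have [] := key _ _ _ _ iT i'T j'T e2 e1 e4 e3; rewrite (negbTE jT).
- have [jT|jT] := boolP (j \in T); have [j'T|j'T] := boolP (j' \in T) => //.
  + by have [_ ->] := key _ _ _ _ i'T iT jT e3 e4 e1 e2.
  + by have [] := key _ _ _ _ i'T iT jT e3 e4 e1 e2; rewrite (negbTE j'T).
  + by have [] := key _ _ _ _ i'T iT j'T e4 e3 e2 e1; rewrite (negbTE jT).
- by [].
Qed.

Variable u : cell -> R.
Hypothesis u0 : forall s, s \in S -> 0 < u s.
Hypothesis S0 : S != set0.

Let tot := \sum_(s in S) u s.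

Definition block_step (ka : cell -> {set cell}) q s :=
  q s * ((\sum_(t in ka s) u t) / (tot * \sum_(t in ka s) q t)).

Definition log_additive q := exists (al : 'I_m -> R) (be : 'I_n -> R),
  forall s, s \in S -> q s = expR (al s.1 + be s.2).

Lemma log_additive_gt0 q s : log_additive q -> s \in S -> 0 < q s.
Proof. by move=> [al [be qE]] sS; rewrite qE// expR_gt0. Qed.

Lemma sum_gt0 q (X : {set cell}) s : (forall t, t \in S -> 0 < q t) -> X \subset S -> s \in X ->
  0 < \sum_(t in X) q t.
Proof.
move=> q0 /fintype.subsetP XS sX; rewrite (bigD1 s)//= ltr_pwDl ?q0 ?XS// sumr_ge0// => t /andP[tX _].
by rewrite ltW// q0// XS.
Qed.

Let tot_gt0 : 0 < tot.
Proof. by have /finset.set0Pn[s sS] := S0; apply: (sum_gt0 (s := s)). Qed.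

Let uhat s := u s / tot.

Let sum_uhat (X : {set cell}) : \sum_(t in X) uhat t = (\sum_(t in X) u t) / tot.
Proof. by rewrite -mulr_suml. Qed.

Let block_stepE ka q s : block_step ka q s =
  q s * ((\sum_(t in ka s) uhat t) / \sum_(t in ka s) q t).
Proof. by rewrite /block_step sum_uhat; congr (_ * _); rewrite invfM mulrA. Qed.

Lemma block_step_additive ka q : block ka -> log_additive q -> log_additive (block_step ka q).
Proof.
move=> [kS kadd] lq; have [al [be qE]] := lq.
have [al' [be' fE]] := kadd (fun X => ln ((\sum_(t in X) uhat t) / \sum_(t in X) q t)).
exists (fun i => al i + al' i), (fun j => be j + be' j) => s sS.
rewrite block_stepE {1}qE//; have := fE s sS; rewrite /= => fs.
have [ss sub _] := kS s sS.
have pos : 0 < (\sum_(t in ka s) uhat t) / \sum_(t in ka s) q t.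
  apply: divr_gt0; apply: (sum_gt0 (s := s)) => // t tS; last exact: log_additive_gt0.
  by rewrite divr_gt0// u0.
by rewrite -[X in _ * X]lnK ?posrE// fs -expRD; congr expR; ring.
Qed.

Lemma block_step_class ka q s : block ka -> log_additive q -> s \in S ->
  \sum_(t in ka s) block_step ka q t = \sum_(t in ka s) uhat t.
Proof.
move=> [kS _] lq sS; have [ss sub same] := kS s sS.
have Q0 : 0 < \sum_(t in ka s) q t.
  by apply: (sum_gt0 (s := s)) => // t tS; exact: log_additive_gt0.
transitivity (\sum_(t in ka s) q t * ((\sum_(t in ka s) uhat t) / \sum_(t in ka s) q t)).
  by apply: eq_bigr => t tk; rewrite block_stepE same.
by rewrite -mulr_suml mulrCA mulfV ?mulr1// gt_eqF.
Qed.

Definition row_mass q r (X : {set 'I_n}) := \sum_(c in X) q (r, c).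
Definition mass q (I : {set 'I_m}) (X : {set 'I_n}) := \sum_(r in I) row_mass q r X.

Lemma massE q I X : \sum_(t in finset.setX I X) q t = mass q I X.
Proof.
rewrite /mass /row_mass pair_big /=; apply: eq_big => [[r c]|[]//].
by rewrite finset.in_setX.
Qed.

(** [Ds] lists the nodes already processed. Column margins are masses of singleton nodes and follow
    by [invariant_mass] once all larger nodes are in [Ds]. *)
Definition ips_invariant (Ds : seq {set 'I_n}) q :=
  [/\ log_additive q, forall r, row_mass q r (nbr r) = row_mass uhat r (nbr r) &
      forall P c, P \in Ds -> c \in P ->
        mass q (common P) (subclass P c) = mass uhat (common P) (subclass P c)].

Lemma sum_rows q : \sum_(s in S) q s = \sum_r row_mass q r (nbr r).
Proof.
rewrite /row_mass pair_big_dep /=; apply: eq_big => [[r c]|[]//].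
by rewrite /= inE.
Qed.

(** Used for the next node in line, where it shows that the step preserves the mass of
    [common T * T], and at the end for singletons, where it gives the column margins. *)
Lemma invariant_mass Ds q T : ips_invariant Ds q -> node T ->
  (forall P, node P -> (#|T| < #|P|)%N -> P \in Ds) ->
  mass q (common T) T = mass uhat (common T) T.
Proof.
move=> [_ qr qD] nT TD; apply/eqP; rewrite -subr_eq0; apply/eqP.
rewrite /mass /row_mass -sumrB; under eq_bigr do rewrite -sumrB.
apply: (@node_sum0 _ _ S Sdf _ (fun s => q s - uhat s)) => // [r|P c nP TP cP].
  by rewrite sumrB; apply/eqP; rewrite subr_eq0; apply/eqP; exact: qr.
under eq_bigr do rewrite sumrB; rewrite sumrB; apply/eqP; rewrite subr_eq0; apply/eqP.
by apply: qD => //; exact: TD.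
Qed.

Lemma row_block_step q : log_additive q -> ips_invariant [::] (block_step row_block q).
Proof.
move=> lq; split=> //; first exact: (block_step_additive row_blockP).
move=> r; have [rs|/finset.set0Pn[c rc]] := eqVneq (nbr r) set0.
  by rewrite /row_mass rs !finset.big_set0.
have rcS : (r, c) \in S by move: rc; rewrite inE.
have rE f : row_mass f r (nbr r) = \sum_(t in row_block (r, c)) f t.
  rewrite /row_mass [RHS](reindex_onto (fun c => (r, c)) snd).
    by apply: eq_bigl => c'; rewrite !inE /= !eqxx !andbT.
  by move=> [r' c']; rewrite inE /= => /andP[_ /eqP ->].
by rewrite !rE block_step_class//; exact: row_blockP.
Qed.

Lemma node_block_step Ds T q : ips_invariant Ds q -> node T -> (1 < #|T|)%N -> T \notin Ds ->
  (forall P, P \in Ds -> node P /\ (#|T| <= #|P|)%N) ->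
  (forall P, node P -> (#|T| < #|P|)%N -> P \in Ds) ->
  ips_invariant (T :: Ds) (block_step (node_block T) q).
Proof.
move=> inv nT T1 TDs DsT TD; have massT := invariant_mass inv nT TD.
have [lq qr qD] := inv; have bT := node_blockP nT T1.
set q' := block_step _ q.
have lq' : log_additive q' by exact: block_step_additive.
have in_block r c : r \in common T -> c \in T ->
    node_block T (r, c) = finset.setX (common T) (subclass T c).
  by move=> rT cT; rewrite /node_block rT cT.
have qTE r c : r \in common T -> c \in T -> q' (r, c) = q (r, c) *
    (mass uhat (common T) (subclass T c) / mass q (common T) (subclass T c)).
  by move=> rT cT; rewrite /q' block_stepE in_block// !massE.
(* The complement of [common T * T] already has the right mass, because [S] and [common T * T] do;
   its factor is 1. *)
have rest (s : cell) : s \in S -> ~~ ((s.1 \in common T) && (s.2 \in T)) -> q' s = q s.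
  case: s => r0 c0 sS sT; rewrite /q' block_stepE /node_block (negbTE sT).
  have sub : finset.setX (common T) T \subset S.
    by apply/fintype.subsetP => -[r c]; rewrite finset.in_setX => /andP[]; exact: common_sub.
  have restE f : \sum_(t in S :\: finset.setX (common T) T) f t =
      \sum_r row_mass f r (nbr r) - mass f (common T) T.
    rewrite -sum_rows -massE [X in _ = X - _](finset.big_setID (finset.setX (common T) T))/=.
    by rewrite (finset.setIidPr sub) addrAC subrr add0r.
  rewrite !restE massT (eq_bigr _ (fun r _ => qr r)) divff ?mulr1// -(eq_bigr _ (fun r _ => qr r)) -massT.
  rewrite -restE gt_eqF//; apply: (sum_gt0 (s := (r0, c0))) => [t tS||].
  - exact: log_additive_gt0 lq tS.
  - exact: finset.subsetDl.
  - by rewrite finset.in_setD sS andbT finset.in_setX.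
have classT c : c \in T ->
    mass q' (common T) (subclass T c) = mass uhat (common T) (subclass T c).
  move=> cT; have [r rT] := node_has_common nT.
  have := block_step_class bT lq (common_sub rT cT).
  by rewrite in_block// !massE.
have classes f : mass f (common T) T =
    \sum_(X in [set subclass T c | c in T]) mass f (common T) X.
  rewrite /mass [RHS]exchange_big /=; apply: eq_bigr => r _; rewrite /row_mass.
  rewrite (partition_big_imset (subclass T))/=; apply: eq_bigr => X /imsetP[c cT ->].
  apply: eq_bigl => c'; apply/andP/idP => [[c'T /eqP <-]|cc']; first exact: subclass_refl.
  split; first exact: (fintype.subsetP (subclass_sub _ _ _) _ cc').
  by rewrite (subclass_eq Sdf nT cT cc').
have massT' : mass q' (common T) T = mass q (common T) T.
  rewrite massT !classes; apply: eq_bigr => X /imsetP[c cT ->]; exact: classT.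
have [al [be qE]] := lq.
(* Each row of [common T] has its mass in [T] multiplied by the same factor [y1 / y0]; comparing the
   totals gives [y1 = y0]. *)
pose y0 := \sum_(c in T) expR (be c).
pose y1 := \sum_(c in T) expR (be c) *
    (mass uhat (common T) (subclass T c) / mass q (common T) (subclass T c)).
have rowq r : r \in common T -> row_mass q r T = expR (al r) * y0.
  move=> rT; rewrite mulr_sumr; apply: eq_bigr => c cT.
  by rewrite (qE _ (common_sub rT cT)) expRD.
have rowq' r : r \in common T -> row_mass q' r T = expR (al r) * y1.
  move=> rT; rewrite mulr_sumr; apply: eq_bigr => c cT.
  by rewrite qTE// (qE _ (common_sub rT cT)) expRD -!mulrA.
have y01 : y1 = y0.
  move: massT'; rewrite /mass (eq_bigr _ rowq) (eq_bigr _ rowq') -!mulr_suml.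
  apply: mulfI; rewrite gt_eqF//; have [r rT] := node_has_common nT.
  by rewrite (bigD1 r)//= ltr_pwDl ?expR_gt0// sumr_ge0// => ? _; exact: expR_ge0.
have keepT r : r \in common T -> row_mass q' r T = row_mass q r T.
  by move=> rT; rewrite rowq// rowq'// y01.
have keep r (X : {set 'I_n}) : X \subset nbr r ->
    (r \in common T -> T \subset X \/ [disjoint T & X]) -> row_mass q' r X = row_mass q r X.
  move=> Xr; have [rT|rT] := boolP (r \in common T); last first.
    move=> _; apply: eq_bigr => c cX; apply: rest; last by rewrite /= (negbTE rT).
    by have := fintype.subsetP Xr _ cX; rewrite inE.
  have out c : c \in X -> c \notin T -> q' (r, c) = q (r, c).
    move=> cX cT; apply: rest; last by rewrite /= (negbTE cT) andbF.
    by have := fintype.subsetP Xr _ cX; rewrite inE.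
  move=> /(_ isT)[TX|TX]; last first.
    apply: eq_bigr => c cX; apply: out => //; apply/negP => cT.
    by move: TX; rewrite disjoint_sym => /disjointFr/(_ cX); rewrite cT.
  rewrite /row_mass [LHS](finset.big_setID T) [RHS](finset.big_setID T)/= (finset.setIidPr TX); congr (_ + _); first exact: keepT.
  by apply: eq_bigr => c; rewrite finset.in_setD => /andP[cT cX]; exact: out.
split=> //.
  move=> r; rewrite -qr; apply: keep => // rT; left.
  by move: rT; rewrite inE.
move=> P c; rewrite in_cons => /orP[/eqP ->|PDs] cP; first exact: classT.
rewrite -qD//; apply: eq_bigr => r rP; have [nP TP] := DsT _ PDs.
have Pr := node_of_sub (node_common Sdf nP rP).
apply: keep => [|rT]; first exact: fintype.subset_trans (subclass_sub _ _ _) Pr.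
(* An earlier class meeting [T] contains it: [T] and [P] are nested in row [r], and [T] is no larger
   than [P] and different from it. *)
have [dis|nd] := boolP [disjoint T & subclass P c]; [by right|left].
move: nd; rewrite -finset.setI_eq0 => /finset.set0Pn[d]; rewrite finset.in_setI => /andP[dT dP].
have dP' := fintype.subsetP (subclass_sub _ _ _) _ dP.
rewrite -(subclass_eq Sdf nP cP dP); apply: (node_subclass Sdf) => //; first by exists r.
have := node_of_laminar Sdf (node_common Sdf nT rT) (node_common Sdf nP rP) dT dP'.
have TneP : T != P by apply: contraNneq TDs => ->.
move=> /orP[TsP|PsT]; first by rewrite finset.properEneq TneP.
by case/eqP: TneP; apply/eqP; rewrite eq_sym finset.eqEcard PsT.
Qed.

End OneCycle.

(** * Maximum likelihood *)

Section MaximumLikelihood.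
Variables (R : realType) (m n : nat) (S : {set 'I_m * 'I_n}).
Notation set0 := finset.set0.
Notation cell := ('I_m * 'I_n)%type.

Lemma margin_row_mass (q : cell -> R) i : margin S q (inl i) = row_mass q i (nbr S i).
Proof.
rewrite /margin big_sumType/= big_pred0 ?add0r//.
by apply: eq_bigl => j; rewrite inE.
Qed.

Lemma margin_col_mass (q : cell -> R) j :
  margin S q (inr j) = mass q (common S [set j]) [set j].
Proof.
rewrite /margin big_sumType/= [X in _ + X]big_pred0 ?addr0// /mass.
apply: eq_big => [i|i _]; first by rewrite inE finset.sub1set inE.
by rewrite /row_mass finset.big_set1.
Qed.

Lemma sum_margins (q : cell -> R) : \sum_(s in S) q s = \sum_i margin S q (inl i).
Proof. by rewrite sum_rows; apply: eq_bigr => i _; rewrite margin_row_mass. Qed.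

(* Birch's theorem, by [1 + t <= expR t] applied to the log-ratio [t]. *)
Lemma is_mle_of_margins (u q : cell -> R) :
  (forall s, s \in S -> 0 < u s) -> S != set0 -> log_additive S q ->
  (forall v, margin S q v = margin S (fun s => u s / \sum_(t in S) u t) v) ->
  is_mle (cell_vector S u) (cell_vector S q).
Proof.
move=> u0 S0 lq mq; set U := \sum_(t in S) u t in mq.
have /finset.set0Pn[s0 s0S] := S0.
have U0 : 0 < U by apply: (@sum_gt0 _ _ _ S u S s0).
have q0 (k : 'I_#|S|) : 0 < q (enum_val k) by exact: (log_additive_gt0 lq (enum_valP k)).
have q1 : \sum_(s in S) q s = 1.
  rewrite sum_margins; under eq_bigr do rewrite mq.
  by rewrite -sum_margins -mulr_suml divff// gt_eqF.
have qmodel : model (cell_vector S q).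
  split=> [k||]; first by rewrite mxE.
    by under eq_bigr do rewrite mxE; rewrite sum_cells.
  have [al [be qE]] := lq; apply: (@additive_sub_A_S _ _ _ _ al be) => k.
  by rewrite !mxE (qE _ (enum_valP k)) expRK.
split=> // p [p0 p1 pA]; set lp := map_mx _ _ in pA.
have [_ _ qA] := qmodel; set lq' := map_mx _ _ in qA.
rewrite -subr_le0 /log_likelihood -sumrB.
pose t (k : 'I_#|S|) := ln (p k 0) - ln (q (enum_val k)).
have -> : \sum_k (cell_vector S u k 0 * ln (p k 0) -
    cell_vector S u k 0 * ln (cell_vector S q k 0)) = \sum_k u (enum_val k) * t k.
  by apply: eq_bigr => k _; rewrite !mxE -mulrBr.
(* The log-ratio lies in the row span of [A_S], and [u / U - q] in its kernel. *)
have ut : \sum_k u (enum_val k) * t k = U * \sum_k q (enum_val k) * t k.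
  have /submxP[y yE] : (lp^T - lq'^T <= A_S R S)%MS by rewrite addmx_sub// eqmx_opp.
  have z0 : A_S R S *m cell_vector S (fun s => u s / U - q s) = 0.
    rewrite A_S_mul; apply/matrixP => i j; rewrite !mxE; case: splitP => l _; rewrite mxE.
      by rewrite marginB -mq subrr.
    by rewrite marginB -mq subrr.
  have := congr1 (fun M => (M *m cell_vector S (fun s => u s / U - q s)) 0 0) yE.
  rewrite -mulmxA z0 mulmx0 mxE [RHS]mxE => E.
  have {}E : \sum_k t k * (u (enum_val k) / U - q (enum_val k)) = 0.
    by rewrite -[RHS]E; apply: eq_bigr => k _; rewrite !mxE.
  apply/eqP; rewrite -subr_eq0 mulr_sumr -sumrB; apply/eqP.
  rewrite -[RHS](mulr0 U) -[X in _ = U * X]E mulr_sumr; apply: eq_bigr => k _.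
  by field; rewrite gt_eqF.
rewrite ut pmulr_rle0//; apply: (@le_trans _ _ (\sum_k (p k 0 - q (enum_val k)))); last first.
  by rewrite sumrB p1 sum_cells q1 subrr.
apply: ler_sum => k _; have -> : p k 0 = q (enum_val k) * expR (t k).
  by rewrite expRD expRN !lnK ?posrE// mulrCA mulfV ?mulr1// gt_eqF.
have := expR_ge1Dx (t k); have := q0 k.
set x := q _; set y := expR _ => x0 y1.
have : 0 <= x * (y - (1 + t k)) by rewrite mulr_ge0 ?subr_ge0// ltW.
by move=> h; rewrite -subr_ge0; rewrite (_ : _ - _ = x * (y - (1 + t k))) //; ring.
Qed.

End MaximumLikelihood.

(** * The block matrices *)

Section BlockMatrices.
Variables (R : realType) (m n : nat) (S : {set 'I_m * 'I_n}).
Notation cell := ('I_m * 'I_n)%type.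
Variable ka : cell -> {set cell}.
Hypothesis kaP : block R S ka.

(** Rows are indexed by all sets of cells; a set that is not a class gives a zero row, which affects
    neither the span nor the unique 1 of each column. *)
Definition block_matrix : 'M[R]_(#|{: {set cell}}|, #|S|) :=
  \matrix_(i, k) (enum_val i == ka (enum_val k))%:R.

Let class_eq (s t : cell) : s \in S -> t \in S -> (ka s == ka t) = (t \in ka s).
Proof.
move=> sS tS; have [ts _ _] := kaP.1 t tS; have [_ _ same] := kaP.1 s sS.
by apply/eqP/idP => [->//|/same ->].
Qed.

Lemma block_matrix_mul (f : cell -> R) i (s : cell) : s \in S -> enum_val i = ka s ->
  (block_matrix *m cell_vector S f) i 0 = \sum_(t in ka s) f t.
Proof.
move=> sS iE; rewrite mxE.
transitivity (\sum_(k < #|S|) (if enum_val k \in ka s then f (enum_val k) else 0)).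
  apply: eq_bigr => k _; rewrite !mxE iE class_eq ?enum_valP//.
  by case: ifP; rewrite ?mul1r ?mul0r.
rewrite (sum_cells S (fun t => if t \in ka s then f t else 0)) -big_mkcondr/=.
have [_ /fintype.subsetP sub _] := kaP.1 s sS; apply: eq_bigl => t.
by case: (boolP (t \in ka s)) => [/sub ->|]; rewrite ?andbF.
Qed.

Lemma ips_step_block (u q : cell -> R) :
  ips_step block_matrix (cell_vector S u) (cell_vector S q) =
  cell_vector S (block_step S u ka q).
Proof.
apply/matrixP => k j; rewrite !mxE.
case: pickP => [i|/(_ (enum_rank (ka (enum_val k))))]; last first.
  by rewrite mxE enum_rankK eqxx eqxx.
rewrite mxE; case: (boolP (enum_val i == _)) => [/eqP iE _|_]; last by rewrite eq_sym oner_eq0.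
rewrite !(block_matrix_mul _ (enum_valP k) iE).
have -> : \sum_t cell_vector S u t 0 = \sum_(s in S) u s.
  by under eq_bigr do rewrite mxE; rewrite sum_cells.
by [].
Qed.

Lemma block_matrix_sub : (block_matrix <= A_S R S)%MS.
Proof.
apply/row_subP => i; have [al [be abE]] := kaP.2 (fun X => (enum_val i == X)%:R).
by apply: (@additive_sub_A_S _ _ _ _ al be) => k; rewrite !mxE -abE ?enum_valP.
Qed.

Lemma block_matrix_multipartition :
  (forall i k, (block_matrix i k == 0) || (block_matrix i k == 1)) /\
  (forall k, exists! i, block_matrix i k = 1).
Proof.
split=> [i k|k]; first by rewrite mxE; case: (enum_val i == _); rewrite eqxx ?orbT.
exists (enum_rank (ka (enum_val k))); split; first by rewrite mxE enum_rankK eqxx.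
move=> i; rewrite mxE; case: eqP => [<- _|_ /eqP]; last by rewrite eq_sym oner_eq0.
by rewrite enum_valK.
Qed.
End BlockMatrices.

(** * The family of blocks: one-cycle convergence and row span *)

Section OneCycleConvergence.
Variables (R : realType) (m n : nat) (S : {set 'I_m * 'I_n}).
Notation set0 := finset.set0.
Notation cell := ('I_m * 'I_n)%type.

Hypothesis Sdf : domino_free S.
Hypothesis Sncc : forall K v, (1 < K)%N -> ~ chordless_cycle S K.*2.+2 v.
Hypothesis S0 : S != set0.

Let larger (P Q : {set 'I_n}) := (#|Q| <= #|P|)%N.

(** Singletons are left out: a member of the family containing the column contains the singleton, so
    [subclass] would be empty. *)
Let nodes : seq {set 'I_n} := sort larger (enum [pred T | node S T && (1 < #|T|)%N]).

Let nodesE T : (T \in nodes) = node S T && (1 < #|T|)%N.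
Proof. by rewrite mem_sort mem_enum inE. Qed.

Lemma set1_mass_eq0 (q : cell -> R) c :
  ~~ node S [set c] -> mass q (common S [set c]) [set c] = 0.
Proof.
move=> nc; rewrite /mass big_pred0// => r; apply/negbTE; apply: contra nc.
rewrite inE finset.sub1set => cr; apply: (node_of_node (r := r)).
have := node_of_trace (set1_family S c) cr (finset.set11 c).
by rewrite (finset.setIidPr _)// finset.sub1set.
Qed.

Definition blocks := row_block S :: [seq node_block S T | T <- nodes].

Lemma blocksP ka : List.In ka blocks -> block R S ka.
Proof.
have key (s : seq {set 'I_n}) : {subset s <= nodes} ->
    List.In ka [seq node_block S T | T <- s] -> block R S ka.
  elim: s => //= T s IH sub [<-|]; last by apply: IH => P Ps; apply: sub; rewrite in_cons Ps orbT.
  have := sub T (mem_head _ _); rewrite nodesE => /andP[nT T1].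
  exact: node_blockP.
by case=> [<-|]; [exact: row_blockP|exact: key].
Qed.

Lemma nth_blocksP l : block R S (nth (row_block S) blocks l).
Proof.
have [lb|lb] := ltnP l (size blocks); last by rewrite nth_default//; exact: row_blockP.
apply: blocksP; elim: blocks l lb => //= ka s IH [|l] lb /=; [by left|right].
exact: IH.
Qed.

Lemma blocks_invariant (u q : cell -> R) : (forall s, s \in S -> 0 < u s) -> log_additive S q ->
  exists Ds, ips_invariant S u Ds (foldl (fun q ka => block_step S u ka q) q blocks) /\
    forall T, node S T -> (1 < #|T|)%N -> T \in Ds.
Proof.
move=> u0 lq /=; have := row_block_step Sncc u0 S0 lq.
move: (block_step _ _ (row_block S) q) => {lq}q inv.
have tr : transitive larger by move=> a b c ab bc; exact: leq_trans bc ab.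
have srt : sorted larger nodes by apply: sort_sorted => P Q; exact: leq_total.
have un : uniq ([::] ++ nodes) by rewrite sort_uniq enum_uniq.
have sub : {subset nodes <= [pred T | node S T && (1 < #|T|)%N]}.
  by move=> T; rewrite nodesE.
have all T : node S T -> (1 < #|T|)%N -> T \in [::] ++ nodes by rewrite nodesE => -> ->.
have big T P : T \in nodes -> P \in ([::] : seq {set 'I_n}) -> (#|T| <= #|P|)%N by [].
have DsN P : P \in ([::] : seq {set 'I_n}) -> node S P by [].
(* Generalised for the induction: [Ds] holds the processed nodes, each at least as large as every
   node still in [s]. *)
move: [::] nodes q inv srt un sub all big DsN => Ds s; elim: s Ds => [|T s IH] Ds q inv srt un sub all big DsN.
  by exists Ds; split=> // T nT T1; have := all T nT T1; rewrite cats0.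
have sT P : P \in s -> (#|P| <= #|T|)%N.
  by move=> Ps; have /allP/(_ _ Ps) := order_path_min tr srt.
have := sub T (mem_head _ _); rewrite inE => /andP[nT T1].
have perm : perm_eq (Ds ++ T :: s) ((T :: Ds) ++ s).
  by rewrite -[T :: s]cat1s catA perm_cat2r -[T :: Ds]cat1s perm_catC.
apply: (IH (T :: Ds)) => /=.
- apply: node_block_step => //.
  + by move: un; rewrite (perm_uniq perm)/= mem_cat negb_or => /andP[/andP[]].
  + by move=> P PDs; split; [exact: DsN|apply: big => //; exact: mem_head].
  + move=> P nP TP; have := all P nP (ltn_trans T1 TP).
    rewrite mem_cat in_cons => /or3P[//|/eqP PT|/sT]; first by rewrite PT ltnn in TP.
    by rewrite leqNgt TP.
- exact: path_sorted srt.
- by have := un; rewrite (perm_uniq perm).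
- by move=> P Ps; apply: sub; rewrite in_cons Ps orbT.
- by move=> P nP P1; have := all P nP P1; rewrite (perm_mem perm).
- move=> P Q Ps; rewrite in_cons => /orP[/eqP ->|QDs]; first exact: sT.
  by apply: big => //; rewrite in_cons Ps orbT.
- by move=> P; rewrite in_cons => /orP[/eqP ->//|/DsN].
Qed.

Let col_entry p q (X : 'M[R]_(p, #|S|)) (Y : 'M[R]_(#|S|, q)) i j :
  (X *m Y) i j = (X *m col j Y) i 0.
Proof. by rewrite !mxE; apply: eq_bigr => k _; rewrite mxE. Qed.

Let b := size blocks.
Let A (l : 'I_b) := block_matrix R S (nth (row_block S) blocks l).

Lemma blocks_converge : one_cycle_convergence A.
Proof.
move=> u u0.
pose v (s : cell) := if [pick k | enum_val k == s] is Some k then u k 0 else 0.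
have uE : u = cell_vector S v.
  apply/matrixP => k j; rewrite (ord1 j) mxE /v.
  by case: pickP => [l /eqP/enum_val_inj ->//|/(_ k)]; rewrite eqxx.
have v0 s : s \in S -> 0 < v s.
  by move=> sS; have := u0 (enum_rank_in sS s); rewrite uE mxE enum_rankK_in.
have N0 : 0 < (#|S|%:R)^-1 :> R by rewrite invr_gt0 ltr0n card_gt0.
have c0 : const_mx (#|S|%:R)^-1 = cell_vector S (fun=> #|S|%:R^-1) :> 'cV[R]_#|S|.
  by apply/matrixP => k j; rewrite !mxE.
have lq : log_additive S (fun=> #|S|%:R^-1 : R).
  by exists (fun=> ln (#|S|%:R^-1)), (fun=> 0) => s _; rewrite addr0 lnK.
have [Ds [inv all]] := blocks_invariant v0 lq.
have -> : ips A u 1 = cell_vector S (foldl (fun q ka => block_step S v ka q) (fun=> #|S|%:R^-1) blocks).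
  have -> : ips A u 1 =
      foldl (fun q l => ips_step (A l) u q) (const_mx (#|S|%:R)^-1) (enum 'I_b) by [].
  rewrite c0 uE.
  have bE : blocks = [seq nth (row_block S) blocks (l : 'I_b) | l <- enum 'I_b].
    rewrite -{1}(mkseq_nth (row_block S) blocks) /mkseq -val_enum_ord -map_comp; exact: eq_map.
  rewrite [X in cell_vector S (foldl _ _ X)]bE.
  elim: (enum 'I_b) (fun=> #|S|%:R^-1 : R) => //= l ls IH q.
  by rewrite /A ips_step_block ?IH//; exact: nth_blocksP.
rewrite uE; apply: is_mle_of_margins => //; first by case: inv.
case=> [r|c]; first by rewrite !margin_row_mass; case: inv => _ ->.
rewrite !margin_col_mass.
have [n1|nn] := boolP (node S [set c]); last by rewrite !set1_mass_eq0.
apply: (invariant_mass Sdf inv n1) => P nP; rewrite cards1 => P1; exact: all.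
Qed.

(** The inclusion of [A_S] is proved dually: a vector killed by all blocks has zero row sums and
    class sums, hence zero column sums by [node_sum0]. *)
Lemma blocks_parametrize : parametrizes A.
Proof.
have spanE := eqmx_col A; apply/andP; split.
  rewrite spanE; apply/sumsmx_subP => l _; rewrite genmxE.
  exact/block_matrix_sub/nth_blocksP.
rewrite submxE; set D := cokermx _.
have AD l : A l *m D = 0.
  apply/eqP; rewrite -submxE spanE; apply: (submx_trans _ (sumsmx_sup l _ _)) => //.
  by rewrite genmxE.
have DE ka : List.In ka blocks -> block_matrix R S ka *m D = 0.
  move=> kab; have [l lb ->] : exists2 l, (l < b)%N & ka = nth (row_block S) blocks l.
    rewrite /b; elim: blocks kab => //= k s IH [<-|/IH[l ls ->]]; first by exists 0%N.
    by exists l.+1.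
  exact: (AD (Ordinal lb)).
apply/eqP/matrixP => i j; rewrite [RHS]mxE.
pose d (s : cell) : R := if [pick k | enum_val k == s] is Some k then D k j else 0.
have dE : col j D = cell_vector S d.
  apply/matrixP => k x; rewrite mxE [RHS]mxE /d.
  by case: pickP => [l /eqP/enum_val_inj ->//|/(_ k)]; rewrite eqxx.
have classes ka s : List.In ka blocks -> s \in S -> \sum_(t in ka s) d t = 0.
  move=> kab sS; rewrite -(@block_matrix_mul R _ _ S ka (blocksP kab) d (enum_rank (ka s)) s sS) ?enum_rankK//.
  by rewrite -dE (colE j D) mulmxA DE// mul0mx mxE.
have rows r : row_mass d r (nbr S r) = 0.
  have [rs|/finset.set0Pn[c rc]] := eqVneq (nbr S r) set0.
    by rewrite /row_mass rs finset.big_set0.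
  have rcS : (r, c) \in S by move: rc; rewrite inE.
  rewrite -(classes (row_block S) (r, c)); [|by left|by []].
  rewrite /row_mass [RHS](reindex_onto (fun c => (r, c)) snd).
    by apply: eq_bigl => c'; rewrite !inE /= !eqxx !andbT.
  by move=> [r' c']; rewrite inE /= => /andP[_ /eqP ->].
have nodeclass P c : node S P -> (1 < #|P|)%N -> c \in P ->
    \sum_(r in common S P) \sum_(c' in subclass S P c) d (r, c') = 0.
  move=> nP P1 cP; have [r rP] := node_has_common nP.
  have inb : List.In (node_block S P) blocks.
    right; apply: List.in_map; have : P \in nodes by rewrite nodesE nP.
    by elim: nodes => //= Q s IH; rewrite in_cons => /orP[/eqP ->|/IH]; [left|right].
  have := classes _ _ inb (common_sub rP cP); rewrite /node_block rP cP massE.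
  by [].
rewrite col_entry.
rewrite dE A_S_mul mxE; case: splitP => l _; rewrite mxE.
  by rewrite margin_row_mass rows.
rewrite margin_col_mass.
have [n1|nn] := boolP (node S [set l]); last by rewrite set1_mass_eq0.
apply: (node_sum0 Sdf n1) => [r|P c nP]; first exact: rows.
by rewrite cards1 => P1; exact: nodeclass.
Qed.

Lemma blocks_multipartition : multipartition A.
Proof. by move=> l; exact: block_matrix_multipartition. Qed.
End OneCycleConvergence.

Lemma ml_degree1_neq0 (R : realType) (m n : nat) (S : {set 'I_m * 'I_n}) :
  has_ml_degree R S 1 -> S != finset.set0.
Proof.
move=> [g g0 gd]; apply/eqP => S0.
have E : #|S| = 0%N by rewrite S0 cards0.
have no (k : 'I_#|S|) : False by have := ltn_ord k; rewrite [X in (_ < X)%N]E.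
(* In zero variables a nonzero polynomial is a nonzero constant, so the empty data are generic; but
   a critical point would make an empty sum equal to 1. *)
have gu : eval_at g (0 : 'cV_#|S|) != 0.
  apply: contraNneq g0 => gu; apply/eqP.
  apply: (@mpoly_vanishing_box R _ g (fun=> 0) 1) => // x _; rewrite -[RHS]gu.
  by apply: meval_eq => k; case: (no k).
have /card_set_bijP[f fb] := gd _ gu.
have [p [_ + _ _] _] := set_bij_surj fb (erefl (1%N <= 1)%N : `I_1%classic 0%N).
rewrite big1 => [/eqP|k]; first by rewrite eq_sym oner_eq0.
by case: (no k).
Qed.

Theorem corollary4p16 (R : realType) (m n : nat) (S : {set 'I_m * 'I_n})
    (hS : has_ml_degree R S 1) :
  exists (b : nat) (r : 'I_b -> nat) (A : forall l : 'I_b, 'M[R]_(r l, #|S|)),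
    [/\ multipartition A, parametrizes A & one_cycle_convergence A].
Proof.
have S0 := ml_degree1_neq0 hS.
have Sdf : domino_free S.
  move=> r r' r'' c c' c'' h1 h2 h3 h4 h5 h6 h7 h8 h9.
  have [H [v0 [z [z' dp]]]] := @domino_double_point R m n S r r' r'' c c' c'' h1 h2 h3 h4 h5 h6 h7 h8 h9.
  exact: double_point_ml_degree dp hS.
have Sncc K v : (1 < K)%N -> ~ chordless_cycle S K.*2.+2 v.
  move=> K1 vC; have [H [v0 [z [z' dp]]]] := @cycle_double_point R m n S K v K1 vC.
  exact: double_point_ml_degree dp hS.
do 3!eexists; split; [exact: blocks_multipartition|exact: blocks_parametrize|].
exact: blocks_converge.
Qed.
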